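(* For $r,s\in\mathbb N$ such that $s\leq r\neq0$, $1\leq\lambda_1<\cdots<\lambda_s\leq r$, and positive real numbers $a_1,\dots,a_r,b_1,\dots,b_s$ satisfying, for all $1\leq i\leq r$ and $1\leq j\leq s$, $b_j>a_i$ if $i\leq\lambda_j$ and $b_j>a_i-1$ if $i\geq\lambda_j+1$, let $(P_n(x))_{n\in\mathbb N}$ be the $r$-orthogonal polynomial sequence defined by $$P_n(x)=\frac{(-1)^n(a_1)_n\cdots(a_r)_n}{\left(b_1^{(n-1)}\right)_n\cdots\left(b_s^{(n-1)}\right)_n}\;{}_{s+1}F_r\left(\left.\begin{matrix}-n,b_1^{(n-1)},\dots,b_s^{(n-1)}\\ a_1,\dots,a_r\end{matrix}\,\right|\,x\right),\qquad b_j^{(n-1)}=b_j+\left\lceil\frac{n-\lambda_j}{r}\right\rceil.$$ Then: (1) all the zeros of $P_n(x)$ are simple, real, and positive, and the zeros of consecutive polynomials interlace; (2) if we denote the zeros of $P_n(x)$ and of ${}_0F_r\left(\left.\begin{matrix}-\\ a_1,\dots,a_r\end{matrix}\,\right|\,-z\right)$, in increasing order, by $\left(x^{(n)}_k\right)_{k=1}^{n}$ and $(f_k)_{k=1}^{\infty}$, respectively, we have $$\lim_{n\to\infty}n^{s+1}\,x^{(n)}_k=r^s\,f_k\qquad\text{for all }k\geq1;$$ (3) there exists a constant $\mathrm K(r,s)\in\mathbb R^+$ such that the largest zero of $P_n(x)$ satisfies $$x^{(n)}_n<\mathrm K(r,s)\,n^{r-s}+o\left(n^{r-s}\right)\qquad\text{as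 }n\to\infty.$$
   Context: $\mathbb N=\{0,1,2,\dots\}$ and $\mathbb R^+=(0,\infty)$; $(z)_0=1$, $(z)_n=z(z+1)\cdots(z+n-1)$ for $n\ge1$; ${}_pF_q\left(\left.\begin{matrix}c_1,\dots,c_p\\ d_1,\dots,d_q\end{matrix}\,\right|\,x\right)=\sum_{n\ge0}\frac{(c_1)_n\cdots(c_p)_n}{(d_1)_n\cdots(d_q)_n}\frac{x^n}{n!}$, where ''$-$'' denotes an empty list of parameters. It is a known fact that the zeros of the entire function $z\mapsto{}_0F_r\left(\left.\begin{matrix}-\\ a_1,\dots,a_r\end{matrix}\,\right|\,-z\right)$ are infinite in number and all real and positive. Interlacing of the zeros of consecutive polynomials means that strictly between any two consecutive zeros of $P_{n+1}$ there is exactly one zero of $P_n$. *)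

(* Defs.v *)
From HB Require Import structures.
From mathcomp Require Import all_boot all_order all_algebra.
From mathcomp Require Import all_classical all_reals all_analysis.
From mathcomp Require Export polyrcf.
From mathcomp Require Export complex.

Set Implicit Arguments.
Unset Strict Implicit.
Unset Printing Implicit Defensive.

Import Order.TTheory GRing.Theory Num.Theory.
Import numFieldNormedType.Exports.

Local Open Scope classical_set_scope.
Local Open Scope ring_scope.

Definition pochhammer (K : pzSemiRingType) (z : K) (n : nat) : K :=
  \prod_(i < n) (z + i%:R).

Definition hyper_coef (K : fieldType) (c d : seq K) (n : nat) : K :=
  (\prod_(t <- c) pochhammer t n) / (\prod_(t <- d) pochhammer t n) / n`!%:R.

(* pFq with upper parameters c and lower parameters d; K is instantiated with
   R for the polynomials and with R[i] for the entire function 0Fr. *)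
Definition hypergeometric (K : numFieldType) (c d : seq K) (x : K) : K :=
  limn (series (fun n => hyper_coef c d n * x ^+ n)).

Section Polynomials.
Variables (R : realType) (r s : nat).
Variables (lam : s.-tuple nat) (a : r.-tuple R) (b : s.-tuple R).

(* The index i : 'I_r is 0-based, so the conditions i <= lambda_j and
   i >= lambda_j + 1 on a 1-based index read i < lambda_j and lambda_j <= i. *)
Definition admissible : Prop :=
  [/\ sorted ltn lam /\ (forall j : 'I_s, (1 <= tnth lam j <= r)%N),
      forall i : 'I_r, 0 < tnth a i,
      forall j : 'I_s, 0 < tnth b j,
      forall (i : 'I_r) (j : 'I_s),
        (i < tnth lam j)%N -> tnth a i < tnth b j
    & forall (i : 'I_r) (j : 'I_s),
        (tnth lam j <= i)%N -> tnth a i - 1 < tnth b j].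

(* b_j^(n-1); n - lambda_j is a difference of reals, hence not truncated. *)
Definition shifted_b (n : nat) : s.-tuple R :=
  [tuple tnth b j + (Num.ceil ((n%:R - (tnth lam j)%:R) / r%:R : R))%:~R
  | j < s].

Definition hyper_prefactor (n : nat) : R :=
  (-1) ^+ n * (\prod_(t <- a) pochhammer t n)
  / (\prod_(t <- shifted_b n) pochhammer t n).

(* The hypergeometric series of P_n terminates, since (-n)_k = 0 for k > n;
   horner_hyper_poly identifies P_n with its defining expression. *)
Definition hyper_poly (n : nat) : {poly R} :=
  hyper_prefactor n *:
    \poly_(k < n.+1) hyper_coef (- n%:R :: shifted_b n) a k.

Lemma pochhammer_eq0 (n k : nat) : (n < k)%N -> pochhammer (- n%:R : R) k = 0.
Proof.
by move=> nk; rewrite /pochhammer (bigD1 (Ordinal nk)) //= addNr mul0r.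
Qed.

Lemma horner_hyper_poly (n : nat) (x : R) :
  (hyper_poly n).[x] =
  hyper_prefactor n * hypergeometric (- n%:R :: shifted_b n) a x.
Proof.
rewrite /hyper_poly hornerZ horner_poly; congr (_ * _).
apply/esym/cvg_lim => //.
rewrite -(cvg_shiftn n.+1); apply: cvg_near_cst; near=> m.
rewrite /series /= (big_cat_nat (n := n.+1)) ?leq_addl //= big_mkord.
rewrite [X in _ + X]big_nat_cond [X in _ + X]big1 ?addr0 // => k.
rewrite andbT => /andP[nk _].
by rewrite /hyper_coef big_cons pochhammer_eq0 // !mul0r.
Unshelve. all: by end_near. Qed.

End Polynomials.

Definition consecutive_roots (R : numDomainType) (p : {poly R}) (x y : R) :=
  [/\ x < y, root p x, root p y & forall z, x < z < y -> ~~ root p z].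

Definition interlaced_by (R : numDomainType) (p q : {poly R}) :=
  forall x y, consecutive_roots p x y ->
    exists! z, x < z < y /\ root q z.

(* The 0-based increasing list f 0 < f 1 < ... of all the complex zeros of F,
   which are thereby all real and infinitely many. *)
Definition increasing_zeros (R : realType) (F : R[i] -> R[i]) (f : nat -> R) :=
  {homo f : k l / (k < l)%N >-> k < l} /\
  forall z : R[i], F z = 0 <-> exists k, z = (f k)%:C%C.

(* Main.v *)
Require Import Defs.
From mathcomp Require Import all_boot all_order all_algebra.
From mathcomp Require Import all_classical all_reals all_analysis.
From mathcomp Require Import polyrcf ring lra zify.

(* The polynomials [P_n] are every [(r+1)]-st term of a sequence [q_m], each [q_m]
   being again hypergeometric, that obeys the recurrence
   [q_(m+1) = X^(e_m) q_m - g_m q_(m-r)] with [g_m > 0] and [e_m = 1] if [r+1]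
   divides [m+1], [e_m = 0] otherwise. The hypotheses on [a] and [b] are exactly
   what makes every [g_m] positive.
   (1) By induction any two terms of a window [q_(m-r), ..., q_m] interlace: the
   sign condition [f' g < 0] at the zeros of [f] is linear in [g], and it makes
   the Wronskian of [f] and [g] nonnegative.
   (2) After scaling, the [P_n] converge coefficientwise to [F = 0Fr(a; -z)], with
   a summable bound, hence locally uniformly. The zeros of [F] are simple: another
   term [q_m] of the same degree tends to a multiple of [a_r F' + z F''], whose
   Wronskian with [F] would change sign at a multiple zero of [F]. Zeros of [P_n]
   therefore follow those of [F] one by one.
   (3) The ratio of consecutive [q_m(x)] stays at least [1/2], after division by
   [x^(e_m)], as soon as [x >= 2^(r+1) max g_m]; and [g_m <= (n + const)^(r-s)]
   holds because each factor [b_j] in a denominator exceeds its own factor of the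
   numerator. *)

Set Implicit Arguments.
Unset Strict Implicit.
Unset Printing Implicit Defensive.

Import Order.TTheory GRing.Theory Num.Theory.
Import numFieldNormedType.Exports.

Local Open Scope ring_scope.

(** * Interlacing of real zeros *)

Section Interlacing.
Variable R : rcfType.
Implicit Types (f g p : {poly R}) (xs : seq R) (x y : R).

(** The passage from [P_n] to [P_(n+1)] is cut into [r+1] steps so that each one raises a single
    numerator parameter [A] and at most one denominator parameter [B]. The change in the coefficient
    of index [l+1] then collapses through [(A+1)(B-l) - (A-l)(B+1) = (l+1)(B-A)]: it is a multiple
    of the coefficient of index [l] of [q_(m-r)], whose numerator parameters are those of [q_(m+1)]
    lowered by 1 and whose denominator parameters are those of [q_m] lowered by 1. The sign of the
    multiple is that of [B-A], and this is where the hypotheses on [a] and [b] enter. In (2), [F']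
    would not do as companion of [F]: at a zero of order [k] the Wronskian of [F] and [-F'], which
    is [F'^2 - F F''], has even order [2k-2] and a positive leading coefficient, so its being
    nonnegative says nothing. At a zero [w > 0] of order [k >= 2], [a_r F' + z F''] has order [k-2],
    which gives the odd order [2k-3]. *)

Definition prodX xs : {poly R} := \prod_(x <- xs) ('X - x%:P).

(** If [f] is monic with simple real zeros, [f'] alternates along them and is positive at the
    largest. For monic [g] the condition therefore puts a zero of [g] after each zero of [f], before
    the next one if there is one. *)
Definition precedes f g := forall x, root f x -> f^`().[x] * g.[x] < 0.

Definition wronskian f g := f * g^`() - f^`() * g.

Lemma root_prodX xs x : root (prodX xs) x = (x \in xs).
Proof. by rewrite /prodX root_prod_XsubC. Qed.

Lemma prodX_cons x xs : prodX (x :: xs) = ('X - x%:P) * prodX xs.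
Proof. by rewrite /prodX big_cons. Qed.

Lemma prodX_cat xs (ys : seq R) : prodX (xs ++ ys) = prodX xs * prodX ys.
Proof. by rewrite /prodX big_cat. Qed.

Lemma horner_prodX xs x : (prodX xs).[x] = \prod_(y <- xs) (x - y).
Proof.
by rewrite /prodX horner_prod; apply: eq_bigr => y _; rewrite hornerXsubC.
Qed.

Lemma prodX_rem xs x : x \in xs -> prodX xs = ('X - x%:P) * prodX (rem x xs).
Proof. by move=> xxs; rewrite /prodX (big_rem x). Qed.

Lemma deriv_prodX_root xs x :
  x \in xs -> (prodX xs)^`().[x] = (prodX (rem x xs)).[x].
Proof.
move=> xxs; rewrite (prodX_rem xxs) derivM derivXsubC mul1r hornerD hornerM.
by rewrite hornerXsubC subrr mul0r addr0.
Qed.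

Lemma lt_sortedW xs : sorted <%R xs -> uniq xs.
Proof. exact: (sorted_uniq lt_trans ltxx). Qed.

Lemma nth_lt xs i j : sorted <%R xs -> (i < j < size xs)%N -> xs`_i < xs`_j.
Proof.
move=> sxs /andP[ij js]; apply: (sorted_ltn_nth lt_trans) => //.
by rewrite inE; apply: ltn_trans js.
Qed.

(* Cancelling the factor [X - x], both derivatives become values of the same
   product, all of whose zeros lie outside [x, y]. *)
Lemma deriv_consecutive xs i : sorted <%R xs -> (i.+1 < size xs)%N ->
  (prodX xs)^`().[xs`_i] * (prodX xs)^`().[xs`_i.+1] < 0.
Proof.
move=> sxs ilt; set x := xs`_i; set y := xs`_i.+1.
have ilt' := ltnW ilt.
have xy : x < y by apply: nth_lt; rewrite // ltnSn.
have Exs : xs = take i xs ++ x :: y :: drop i.+2 xs.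
  by rewrite -{1}(cat_take_drop i xs) (drop_nth 0 ilt') (drop_nth 0 ilt).
have : forall z, z \in take i xs ++ drop i.+2 xs -> 0 < (x - z) * (y - z).
  move=> z; rewrite mem_cat => /orP[] /(nthP 0)[k].
    rewrite size_take ilt' => ki <-; rewrite nth_take //.
    have : xs`_k < x by apply: nth_lt; rewrite // ki.
    by move=> kx; apply: mulr_gt0; rewrite subr_gt0 // (lt_trans kx).
  rewrite size_drop nth_drop => ki <-.
  have : y < xs`_(i.+2 + k).
    apply: nth_lt => //; rewrite addSn ltnS leq_addr /= -addSn -ltn_subRL.
    by [].
  by move=> kx; rewrite nmulr_rgt0 subr_lt0 // (lt_trans xy).
have -> : prodX xs =
    ('X - x%:P) * (('X - y%:P) * prodX (take i xs ++ drop i.+2 xs)).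
  by rewrite {1}Exs !prodX_cat !prodX_cons; ring.
set s := _ ++ _; move=> sP.
have : 0 < (prodX s).[x] * (prodX s).[y].
  rewrite !horner_prodX -big_split /= big_seq.
  by apply: prodr_gt0 => z /sP.
rewrite !(derivM, derivXsubC) !(hornerD, hornerN, hornerM, hornerX, hornerC).
set h := (prodX s).[x]; set k := (prodX s).[y]; move=> hk.
rewrite (_ : _ * _ = - (y - x) ^+ 2 * (h * k)); last by ring.
by rewrite mulNr oppr_lt0 mulr_gt0 // exprn_gt0 // subr_gt0.
Qed.

Lemma root_between g x y : x < y -> g.[x] * g.[y] < 0 ->
  exists2 z, x < z < y & root g z.
Proof.
move=> xy /(poly_ivtoo (ltW xy))[z]; rewrite in_itv /= => zxy gz.
by exists z.
Qed.

Lemma consecutive_sign (d e u v : R) :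
  d * e < 0 -> 0 < (d * u) * (e * v) -> u * v < 0.
Proof.
move=> de; rewrite (_ : _ * _ = (d * e) * (u * v)); last by ring.
by rewrite nmulr_rgt0.
Qed.

Lemma precedes_consecutive xs g i : sorted <%R xs -> (i.+1 < size xs)%N ->
  precedes (prodX xs) g -> g.[xs`_i] * g.[xs`_i.+1] < 0.
Proof.
move=> sxs ilt fg; apply: (consecutive_sign (deriv_consecutive sxs ilt)).
by rewrite nmulr_rgt0; apply: fg; rewrite root_prodX mem_nth // ltnW.
Qed.

(** Each sign change gives a zero of [g], and one more lies beyond the last point, where [g] climbs
    from a negative value to infinity. Together they exhaust the degree. *)
Lemma split_of_signs g (zs : seq R) : g \is monic -> size g = (size zs).+1 ->
    sorted <%R zs ->
    (forall i, (i.+1 < size zs)%N -> g.[zs`_i] * g.[zs`_i.+1] < 0) ->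
    ((0 < size zs)%N -> g.[zs`_(size zs).-1] < 0) ->
  exists ys : seq R, [/\ size ys = size zs, sorted <%R ys,
    forall i, (i < size zs)%N -> zs`_i < ys`_i & g = prodX ys].
Proof.
move=> gm sg szs sgn lst.
have ex i : exists y, (i < size zs)%N ->
    [/\ root g y, zs`_i < y & (i.+1 < size zs)%N -> y < zs`_i.+1].
  have [il|] := ltnP i (size zs); last by exists 0.
  have [il'|il'] := ltnP i.+1 (size zs).
    have /root_between/(_ (sgn _ il'))[y /andP[iy yi] gy] : zs`_i < zs`_i.+1.
      by apply: nth_lt; rewrite // ltnSn.
    by exists y.
  have Ei : i = (size zs).-1 by lia.
  have [b bP] : exists n, forall x, x >= n -> g.[x] >= lead_coef g.
    by apply: poly_pinfty_gt_lc; rewrite (monicP gm).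
  have gi : g.[zs`_i] < 0 by rewrite Ei; apply: lst; lia.
  pose t := Num.max b (zs`_i + 1).
  have it : zs`_i < t by rewrite lt_max ltrDl ltr01 orbT.
  have gt : 0 < g.[t].
    by rewrite (lt_le_trans _ (bP t _)) ?(monicP gm) // le_max lexx.
  have [|y /andP[iy yi] gy] := @root_between g _ _ it.
    by rewrite nmulr_rlt0.
  by exists y.
have [Y YP] := boolp.choice ex.
exists (mkseq Y (size zs)).
have sys : sorted <%R (mkseq Y (size zs)).
  apply/(sortedP 0) => i; rewrite size_mkseq => il.
  rewrite !nth_mkseq //; last exact: ltnW.
  have [_ _ /(_ il) h1] := YP _ (ltnW il).
  have [_ h2 _] := YP _ il; exact: lt_trans h1 h2.
split=> //; first by rewrite size_mkseq.
  by move=> i il; rewrite nth_mkseq //; have [] := YP _ il.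
rewrite (@all_roots_prod_XsubC _ g (mkseq Y (size zs))) ?size_mkseq //.
- by rewrite (monicP gm) scale1r.
- apply/allP => y /mapP[k]; rewrite mem_iota => /= kl ->.
  by have [] := YP k kl.
- by rewrite uniq_rootsE lt_sortedW.
Qed.

Lemma wronskianDr f g h : wronskian f (g + h) = wronskian f g + wronskian f h.
Proof. by rewrite /wronskian derivD; ring. Qed.

(* Lagrange interpolation at the zeros of [f = prodX xs] writes
   [g = u f - sum_x lam_x f / (X - x)] with every [lam_x > 0] and [u] monic of
   degree at most 1, whence [W(f, g) = u' f^2 + sum_x lam_x (f / (X - x))^2]. *)
Lemma wronskian_decomposition xs g : sorted <%R xs -> g \is monic ->
    size g = (size xs).+1 \/ size g = (size xs).+2 ->
    precedes (prodX xs) g ->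
  exists u0 : R, exists lam : R -> R,
  [/\ 0 <= u0, (size g = (size xs).+2 -> u0 = 1),
      (forall x, x \in xs -> 0 < lam x)
    & forall y, (wronskian (prodX xs) g).[y] =
        u0 * (prodX xs).[y] ^+ 2
        + \sum_(x <- xs) lam x * (prodX (rem x xs)).[y] ^+ 2].
Proof.
move=> sxs gm sg fg; set f := prodX xs.
have uxs := lt_sortedW sxs.
pose lam x := - (g.[x] / f^`().[x]).
have lamP x : x \in xs -> 0 < lam x.
  move=> xxs; have := fg x; rewrite root_prodX => /(_ xxs) fg0.
  rewrite /lam oppr_gt0.
  have f0 : f^`().[x] != 0 by apply: contraTneq fg0 => ->; rewrite mul0r ltxx.
  have -> : g.[x] / f^`().[x] = (f^`().[x] * g.[x]) * (f^`().[x] ^- 2).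
    by field.
  by rewrite pmulr_llt0 // invr_gt0 exprn_even_gt0.
pose L := \sum_(x <- xs) lam x *: prodX (rem x xs).
have sL : (size L <= size xs)%N.
  rewrite /L big_seq; apply: (big_ind (fun p : {poly R} => size p <= size xs)%N).
  - by rewrite size_poly0.
  - by move=> p q hp rec_poly; rewrite (leq_trans (size_polyD _ _)) // geq_max hp.
  - move=> x xxs; rewrite (leq_trans (size_scale_leq _ _)) //.
    rewrite /prodX size_prod_XsubC size_rem // prednK //.
    by case: xs xxs {sxs sg fg f uxs lam lamP L}.
have sLg : (size L < size g)%N by rewrite (leq_ltn_trans sL) //; case: sg => ->.
have f_dvd : f %| g + L.
  have -> : f = \prod_(x <- xs) ('X - x%:P) by [].
  apply: uniq_roots_dvdp; last by rewrite uniq_rootsE.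
  apply/allP => x xxs; rewrite rootE hornerD /L horner_sum (big_rem x) //= addrA.
  rewrite [X in _ + X]big_seq [X in _ + X]big1 ?addr0.
    rewrite hornerZ -deriv_prodX_root // /lam mulNr divfK ?subrr //.
    have := fg x; rewrite root_prodX => /(_ xxs).
    by apply: contraTneq => ->; rewrite mul0r ltxx.
  move=> y; rewrite mem_rem_uniq // => /andP[/= yx yxs].
  rewrite hornerZ (prodX_rem (x := x)); last first.
    by rewrite mem_rem_uniq // inE /= eq_sym yx.
  by rewrite hornerM hornerXsubC subrr mul0r mulr0.
have [u Eu] : exists u, g + L = u * f by exists ((g + L) %/ f); rewrite divpK.
have fm : f \is monic by rewrite monic_prod_XsubC.
have gLm : g + L \is monic.
  by rewrite monicE lead_coefDl // (monicP gm).
have um : u \is monic by move: gLm; rewrite Eu monicMr.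
have su : (size g = size u + size xs)%N.
  have : size (g + L) = size g by rewrite size_polyDl.
  rewrite Eu size_monicM ?monic_neq0 // => <-.
  by rewrite /f /prodX size_prod_XsubC addnS.
have wu : wronskian f (u * f) = u^`() * f ^+ 2.
  by rewrite /wronskian derivM; ring.
have wL y : (wronskian f L).[y] = - \sum_(x <- xs) lam x * (prodX (rem x
  xs)).[y] ^+ 2.
  have : wronskian f L = \sum_(x <- xs) lam x *: wronskian f (prodX (rem x xs)).
    rewrite /wronskian /L raddf_sum !mulr_sumr -sumrB.
    by apply: eq_bigr => x _ /=; rewrite derivZ -!scalerAr scalerBr.
  move=> ->; rewrite horner_sum -sumrN big_seq [RHS]big_seq.
  apply: eq_bigr => x xxs; rewrite hornerZ -mulrN; congr (_ * _).
  rewrite /wronskian /f {1 2}(prodX_rem xxs) derivM derivXsubC mul1r.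
  by rewrite !(hornerD, hornerN, hornerM, hornerX, hornerC); ring.
have WE y : (wronskian f g).[y] = u^`().[y] * f.[y] ^+ 2
    + \sum_(x <- xs) lam x * (prodX (rem x xs)).[y] ^+ 2.
  have -> : (wronskian f g).[y] = (wronskian f (u * f)).[y] - (wronskian f L).[y].
    by rewrite -Eu wronskianDr [in RHS]hornerD addrK.
  by rewrite wL opprK wu hornerM horner_exp.
exists (u^`()).[0], lam.
have duE y : u^`().[y] = u^`().[0].
  have : (size u^`() <= 1)%N.
    by rewrite (leq_trans (size_poly _ _)) //; case: sg => sg; lia.
  by move/size1_polyC => ->; rewrite !hornerC.
split=> //; last by move=> y; rewrite WE duE.
- case: sg => sg.
    have : size u = 1%N by lia.
    by move/eqP/size_poly1P => [c _ ->]; rewrite derivC horner0.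
  have su2 : size u = 2%N by lia.
  have -> : u^`().[0] = 1; last exact: ler01.
  rewrite horner_coef0 coef_deriv mulr1n.
  by move: um; rewrite monicE lead_coefE su2 => /eqP.
- move=> sg'; have su2 : size u = 2%N by lia.
  rewrite horner_coef0 coef_deriv mulr1n.
  by move: um; rewrite monicE lead_coefE su2 => /eqP.
Qed.

Lemma wronskian_ge0 xs g y : sorted <%R xs -> g \is monic ->
    size g = (size xs).+1 \/ size g = (size xs).+2 ->
    precedes (prodX xs) g -> 0 <= (wronskian (prodX xs) g).[y].
Proof.
move=> sxs gm sg fg.
have [u0 [lam [u0_ge0 _ lamP ->]]] := wronskian_decomposition sxs gm sg fg.
apply: addr_ge0; first by rewrite mulr_ge0 // sqr_ge0.
rewrite big_seq; apply: sumr_ge0 => x xxs.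
by rewrite mulr_ge0 ?sqr_ge0 // ltW // lamP.
Qed.

(** At a zero of [g] the Wronskian reduces to [f g']. It is positive there because [f] and [g] have
    no common zero, so that every [f / (X - x)] is nonzero at [y]; if [f = 1], then [g] has degree 1
    and the term [u' f^2 = 1] takes over. *)
Lemma precedes_dual xs g y : sorted <%R xs -> g \is monic ->
    size g = (size xs).+1 \/ size g = (size xs).+2 ->
    precedes (prodX xs) g -> root g y -> 0 < g^`().[y] * (prodX xs).[y].
Proof.
move=> sxs gm sg fg gy.
have [u0 [lam [u0_ge0 u01 lamP WE]]] := wronskian_decomposition sxs gm sg fg.
have fy0 : (prodX xs).[y] != 0.
  apply/eqP => fy; have := fg y; rewrite rootE fy eqxx => /(_ isT).
  by rewrite (rootP gy) mulr0 ltxx.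
have := WE y; rewrite /wronskian hornerD hornerN !hornerM (rootP gy) mulr0
  subr0 mulrC => ->.
case: xs sxs sg fg u01 lamP fy0 {WE} => [|x xs] sxs sg fg u01 lamP fy0.
  rewrite big_nil addr0 mulr_gt0 ?exprn_even_gt0 //.
  case: sg => /= sg; last by rewrite (u01 sg) ltr01.
  by have := root_size_gt1 (monic_neq0 gm) gy; rewrite sg.
rewrite big_cons; apply: ltr_wpDl; first by rewrite mulr_ge0 ?sqr_ge0.
apply: ltr_pwDl.
  rewrite mulr_gt0 ?lamP ?mem_head // exprn_even_gt0 //=.
  by move: fy0; rewrite (prodX_rem (mem_head x xs)) hornerM mulf_eq0 negb_or =>
    /andP[].
rewrite big_seq; apply: sumr_ge0 => z zxs.
by rewrite mulr_ge0 ?sqr_ge0 // ltW // lamP // inE zxs orbT.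
Qed.

Lemma precedes_last xs g : sorted <%R xs -> precedes (prodX xs) g ->
  (0 < size xs)%N -> g.[xs`_(size xs).-1] < 0.
Proof.
move=> sxs fg; case/lastP: xs sxs fg => // s x sxs fg _.
rewrite size_rcons /= nth_rcons ltnn eqxx.
have := fg x; rewrite root_prodX mem_rcons mem_head => /(_ isT).
suff d0 : 0 < (prodX (rcons s x))^`().[x] by rewrite pmulr_rlt0.
rewrite -cats1 prodX_cat prodX_cons /prodX big_nil mulr1 -/(prodX s).
rewrite !(derivM, derivXsubC) !(hornerD, hornerN, hornerM, hornerX, hornerC)
  subrr mulr0 add0r mulr1.
rewrite horner_prodX big_seq; apply: prodr_gt0 => z zs.
rewrite subr_gt0; move: sxs; rewrite -cats1.
by rewrite (sorted_pairwise lt_trans) pairwise_cat => /and3P[/allrelP -> //];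
  rewrite mem_head.
Qed.

(** When [g] has one zero more than [f], the extra one lies below all zeros of [f]. The sign
    condition at 0 makes 0 a further sample point, which keeps this zero positive. *)
Lemma precedes_split xs g : sorted <%R xs -> all (> 0) xs -> g \is monic ->
    size g = (size xs).+1 \/
    (size g = (size xs).+2 /\ g.[0] * (prodX xs).[0] < 0) ->
    precedes (prodX xs) g ->
  exists ys : seq R, [/\ size ys = (size g).-1, sorted <%R ys, all (> 0) ys
    & g = prodX ys].
Proof.
move=> sxs xs0 gm sg fg.
have conc (zs : seq R) : size g = (size zs).+1 -> all (>= 0) zs ->
    (exists ys : seq R, [/\ size ys = size zs, sorted <%R ys,
      forall i, (i < size zs)%N -> zs`_i < ys`_i & g = prodX ys]) ->
    exists ys : seq R, [/\ size ys = (size g).-1, sorted <%R ys, all (> 0) ys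
    & g = prodX ys].
  move=> -> zs0 [ys [sy sys zy gE]]; exists ys; split=> //.
  apply/(all_nthP 0) => i; rewrite sy => il.
  by apply: le_lt_trans (zy i il); have /(all_nthP 0)/(_ i il) := zs0.
case: sg => [sg|[sg g0]].
  apply: (conc xs) => //; first by apply: sub_all xs0 => x /ltW.
  apply: split_of_signs => // [i il|].
    exact: precedes_consecutive.
  exact: precedes_last.
apply: (conc (0 :: xs)); first by rewrite sg.
  by rewrite /= lexx; apply: sub_all xs0 => x /ltW.
apply: split_of_signs => //=.
- by rewrite path_min_sorted.
- case=> [|i] il /=; last exact: precedes_consecutive.
  case: xs sxs xs0 fg {sg conc} g0 il => //= x xs sxs /andP[x0 _] fg g0 _.
  have h : (prodX (x :: xs)).[0] * (prodX (x :: xs))^`().[x] < 0.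
    rewrite prodX_cons !(derivM, derivXsubC) !(hornerD, hornerN, hornerM,
      hornerX, hornerC).
    rewrite (_ : _ * _ = - (x * ((prodX xs).[0] * (prodX xs).[x]))); last by ring.
    rewrite oppr_lt0 mulr_gt0 // !horner_prodX -big_split /= big_seq.
    apply: prodr_gt0 => z zs.
    have xz : x < z by have /allP := order_path_min lt_trans sxs; apply.
    by rewrite nmulr_rgt0 subr_lt0 // (lt_trans x0).
  apply: (consecutive_sign h).
  rewrite nmulr_rgt0; last by rewrite mulrC.
  by apply: fg; rewrite root_prodX mem_head.
- move=> _; case: xs sxs xs0 fg {sg conc} g0 => [|x xs] sxs xs0 fg g0 /=.
    by move: g0; rewrite /prodX big_nil hornerC mulr1.
  exact: (precedes_last sxs fg).
Qed.

End Interlacing.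

(** * Periodic recurrences *)

Lemma nth_gt_index (R : rcfType) (xs : seq R) i j : sorted <%R xs ->
  (i < size xs)%N -> (j < size xs)%N -> xs`_i < xs`_j -> (i < j)%N.
Proof.
move=> sxs il jl; rewrite ltnNge leq_eqVlt; apply: contraTN => /orP[/eqP ->|ji].
  by rewrite ltxx.
by apply/negP; rewrite lt_gtF // nth_lt // ji.
Qed.

(** By duality [f] changes sign between consecutive zeros of [g]. Two zeros of [f] in the same gap
    would enclose a zero of [g], since [g] alternates along the zeros of [f]. *)
Lemma precedes_interlaced (R : rcfType) (xs ys : seq R) (x y : R) :
    sorted <%R xs -> sorted <%R ys ->
    size ys = size xs \/ size ys = (size xs).+1 ->
    precedes (prodX xs) (prodX ys) ->
    x < y -> root (prodX ys) x -> root (prodX ys) y ->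
    (forall z, x < z < y -> ~~ root (prodX ys) z) ->
  exists! z, x < z < y /\ root (prodX xs) z.
Proof.
move=> sxs sys sz fg xy gx gy gz.
have gm : prodX ys \is monic by rewrite monic_prod_XsubC.
have sg : size (prodX ys) = (size xs).+1 \/ size (prodX ys) = (size xs).+2.
  by rewrite size_prod_XsubC; case: sz => ->; [left|right].
have : x \in ys by rewrite -root_prodX.
move=> /(nthP 0)[i il Ex].
have : y \in ys by rewrite -root_prodX.
move=> /(nthP 0)[j jl Ey].
have ij : (i < j)%N by apply: (nth_gt_index sys); rewrite // Ex Ey.
have Ej : j = i.+1.
  apply/eqP; rewrite eqn_leq ij andbT leqNgt; apply/negP => ij1.
  have il1 : (i.+1 < size ys)%N := ltn_trans ij1 jl.
  have /gz : x < ys`_i.+1 < y by rewrite -Ex -Ey !nth_lt // ?ij1 ?ltnSn.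
  by rewrite root_prodX mem_nth.
have fxy : (prodX xs).[x] * (prodX xs).[y] < 0.
  have := deriv_consecutive sys (i := i); rewrite -Ej Ex Ey => /(_ jl) gg.
  by apply: (consecutive_sign gg); rewrite mulr_gt0 // precedes_dual.
have [z zxy fz] := root_between xy fxy.
exists z; split=> // z' [z'xy fz'].
have uniq_lt u v : x < u < y -> x < v < y -> root (prodX xs) u ->
    root (prodX xs) v -> u < v -> False.
  move=> /andP[xu _] /andP[_ vy]; rewrite !root_prodX.
  move=> /(nthP 0)[k kl Eu] /(nthP 0)[l ll Ev] uv.
  have kl' : (k < l)%N by apply: (nth_gt_index sxs); rewrite // Eu Ev.
  have k1l : (k.+1 < size xs)%N := leq_ltn_trans kl' ll.
  have k1v : xs`_k.+1 <= v.
    move: kl'; rewrite leq_eqVlt => /orP[/eqP ->|k1l']; first by rewrite Ev.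
    by rewrite -Ev ltW // nth_lt // k1l'.
  have /root_between/(_ (precedes_consecutive sxs k1l fg)) : xs`_k < xs`_k.+1.
    by rewrite nth_lt // ltnSn.
  rewrite Eu => -[w /andP[uw wk] gw].
  have := gz w; rewrite gw (lt_trans xu uw) (lt_trans wk) ?(le_lt_trans k1v) //.
  by move=> /(_ isT).
apply/eqP; rewrite eq_le !leNgt; apply/andP; split; apply/negP.
  exact: uniq_lt.
exact: uniq_lt.
Qed.

Section Recurrence.
Variables (R : rcfType) (r : nat) (q : nat -> {poly R}) (gam : nat -> R).
Hypothesis r_gt0 : (0 < r)%N.
Hypothesis q_init : forall m, (m <= r)%N -> q m = 1.
Hypothesis q_rec : forall m, (r <= m)%N ->
  q m.+1 = (if (r.+1 %| m.+1)%N then 'X * q m else q m) - gam m *: q (m - r)%N.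
Hypothesis gam_gt0 : forall m, (r <= m)%N -> 0 < gam m.

Lemma divS_sub m : (r <= m)%N -> (m.+1 %/ r.+1 = ((m - r) %/ r.+1).+1)%N.
Proof.
move=> rm; rewrite (_ : m.+1 = (m - r) + r.+1)%N; last by rewrite addnS subnK.
by rewrite divnDr ?dvdnn // divnn addn1.
Qed.

Lemma rec_size_monic m : q m \is monic /\ size (q m) = (m %/ r.+1).+1.
Proof.
elim/ltn_ind: m => m IH; have [mr|] := leqP m r.
  by rewrite q_init // monic1 size_poly1 divn_small.
case: m IH => // m IH; rewrite ltnS => rm.
have [m1 s1] := IH m (ltnSn m).
have [_ s2] : q (m - r) \is monic /\ size (q (m - r)) = ((m - r) %/ r.+1).+1.
  by apply: IH; rewrite ltnS leq_subr.
pose g := if (r.+1 %| m.+1)%N then 'X * q m else q m.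
have [gm sg] : g \is monic /\ size g = (m.+1 %/ r.+1).+1.
  rewrite /g divnS //; case: ifP => _; last by rewrite add0n.
  by rewrite monicMr ?monicX // size_monicM ?monicX ?monic_neq0 // size_polyX s1.
have lt_s : (size (- (gam m *: q (m - r)%N)) < size g)%N.
  by rewrite size_polyN size_scale ?gt_eqF ?gam_gt0 // s2 sg divS_sub.
rewrite q_rec // -/g; split; last by rewrite size_polyDl.
by rewrite monicE lead_coefDl // (monicP gm).
Qed.

Definition splits_positively m := exists xs : seq R, [/\ size xs = (m %/ r.+1)%N,
  sorted <%R xs, all (> 0) xs & q m = prodX xs].

Lemma split_dual i j y : splits_positively i -> (i <= j <= i + r.+1)%N ->
  precedes (q i) (q j) -> root (q j) y ->
  0 < (q j)^`().[y] * (q i).[y].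
Proof.
move=> [xs [sx sxs _ ->]] /andP[ij jr] pre ry.
have [mj szj] := rec_size_monic j.
apply: precedes_dual => //; rewrite szj sx.
have : (i %/ r.+1 <= j %/ r.+1)%N by apply: leq_div2r.
have : (j %/ r.+1 <= (i %/ r.+1).+1)%N.
  by rewrite (leq_trans (leq_div2r _ jr)) // divnDr // divnn /= addn1.
lia.
Qed.

(** At a zero [x > 0] of [q_i], [m-r < i <= m], both terms of [q_(m+1)] push in the same direction:
    [X^(e_m) q_m] by induction (it vanishes if [i = m]), and [- g_m q_(m-r)] by duality, because
    [q_(m-r)] precedes [q_i]. *)
Lemma rec_interlacing m : splits_positively m /\
  forall i j, (i < j <= m)%N -> (j <= i + r)%N -> precedes (q i) (q j).
Proof.
elim/ltn_ind: m => m IH; have [mr|] := leqP m r.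
  split; first by exists [::]; rewrite /prodX big_nil divn_small // q_init.
  move=> i j /andP[ij jm] _ x; rewrite (q_init (m := i)) ?rootC ?oner_eq0 //.
  by rewrite (leq_trans (ltnW ij)) // (leq_trans jm).
case: m IH => // m IH; rewrite ltnS => rm.
have spl i : (i <= m)%N -> splits_positively i by move=> im; have [] := IH i im.
have pre i j : (i < j <= m)%N -> (j <= i + r)%N -> precedes (q i) (q j).
  by have [_] := IH m (ltnSn m); exact.
have lt_sub : (m - r < m)%N by rewrite ltn_subrL r_gt0 (leq_trans r_gt0).
have preS i : (i < m.+1)%N -> (m.+1 <= i + r)%N -> precedes (q i) (q m.+1).
  move=> im mi x qx; have lei : (m - r < i)%N by lia.
  rewrite q_rec // hornerD hornerN hornerZ mulrDr.
  have lhs : 0 < (q i)^`().[x] * (q (m - r)).[x].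
    apply: split_dual => //; [exact: spl (ltnW lt_sub)|lia|].
    by apply: pre; lia.
  have {lhs} lhs : (q i)^`().[x] * - (gam m * (q (m - r)).[x]) < 0.
    by rewrite mulrN oppr_lt0 mulrCA mulr_gt0 ?gam_gt0.
  have [xs [_ _ xs0 Ei]] := spl i im.
  have x0 : 0 < x.
    by move: qx; rewrite Ei root_prodX => /(allP xs0).
  move: im; rewrite ltnS leq_eqVlt => /orP[/eqP Em|im].
    by rewrite -Em in lhs *; case: ifP => _;
      rewrite ?hornerM (rootP qx) !mulr0 add0r.
  have rhs : (q i)^`().[x] * (q m).[x] < 0 by apply: pre => //; lia.
  rewrite -[ltRHS]addr0; apply: ltrD; last exact: lhs.
  case: ifP => _; last exact: rhs.
  by rewrite hornerM hornerX mulrCA (pmulr_rlt0 _ x0); exact: rhs.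
split; last first.
  move=> i j /andP[ij]; rewrite leq_eqVlt => /orP[/eqP Ej|jm].
    by rewrite Ej in ij *; exact: preS.
  by apply: pre; rewrite ij.
have [xs [sx sxs xs0 Em]] := spl m (leqnn m).
have [qm sq] := rec_size_monic m.+1.
have /(@precedes_split _ xs) H : precedes (prodX xs) (q m.+1).
  by rewrite -Em; apply: preS => //; lia.
suff /H[|||ys [sy sys ys0 Ey]] : size (q m.+1) = (size xs).+1 \/
    size (q m.+1) = (size xs).+2 /\ (q m.+1).[0] * (prodX xs).[0] < 0.
- by [].
- by [].
- by [].
- by exists ys; rewrite sy sq.
rewrite sq sx divnS //; case: (boolP (_ %| _)%N) => dv; [right|by left].
(* At 0 only [- g_m q_(m-r)] survives. The degree jumps at [m+1], so [q_(m-r)] and [q_m] still have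
   the same degree and, all their zeros being positive, the same sign at 0. *)
split=> //; rewrite q_rec // dv hornerD hornerN hornerZ hornerM hornerX mul0r.
have [ys [sy sys ys0 ->]] := spl (m - r)%N (ltnW lt_sub).
rewrite add0r mulNr oppr_lt0 -mulrA mulr_gt0 ?gam_gt0 //.
have sgn0 (zs : seq R) : all (> 0) zs -> exists2 t, 0 < t & (prodX zs).[0] =
  (-1) ^+ size zs * t.
  elim: zs => [|z zs IHz] /=.
    by exists 1; rewrite ?ltr01 // /prodX big_nil hornerC expr0 mulr1.
  move=> /andP[z0 /IHz[t t0 Et]]; exists (z * t); first exact: mulr_gt0.
  by rewrite prodX_cons hornerM hornerXsubC Et exprS sub0r; ring.
have [t t0 ->] := sgn0 _ xs0; have [u u0 ->] := sgn0 _ ys0.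
have -> : size ys = size xs.
  by have := divS_sub rm; rewrite sx sy divnS // dv => -[].
by rewrite mulrACA -expr2 sqrr_sign mul1r mulr_gt0.
Qed.

Lemma rec_splits m : splits_positively m.
Proof. by have [] := rec_interlacing m. Qed.

Lemma rec_precedes i j : (i < j <= i + r)%N -> precedes (q i) (q j).
Proof.
by move=> /andP[ij jr]; have [_] := rec_interlacing j; apply; rewrite // ij leqnn.
Qed.

(** The two indices differ by [r+1], one more than the window allows; but at a zero of [q_i] the
    recurrence leaves [q_(i+r+1) = X q_(i+r)], and [i+r] is in the window. *)
Lemma rec_precedes_period n : precedes (q (r.+1 * n)%N) (q (r.+1 * n.+1)%N).
Proof.
move=> x qx; set i := (r.+1 * n)%N in qx *.
have -> : (r.+1 * n.+1 = (i + r).+1)%N by rewrite mulnS -/i addnC addnS.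
have dv : (r.+1 %| (i + r).+1)%N by rewrite -addnS dvdn_add // /i dvdn_mulr.
rewrite q_rec ?leq_addl // dv addnK hornerD hornerN hornerZ (rootP qx).
rewrite mulr0 subr0 hornerM hornerX mulrCA pmulr_rlt0.
  by apply: rec_precedes => //; lia.
have [xs [_ _ xs0 Ei]] := rec_splits i.
by move: qx; rewrite Ei root_prodX => /(allP xs0).
Qed.

(* [v m = q_m(x) / x^(deg q_m)] satisfies [v (m + 1) = v m - (gam m / x) v (m -
  r)]
   whatever the residue of [m], so that [v] at most halves at each step. *)
Lemma rec_gt0 (M : nat) (x : R) : 0 < x ->
  (forall m, (r <= m < M)%N -> 2 ^+ r.+1 * gam m <= x) -> 0 < (q M).[x].
Proof.
move=> x0 gx; pose v m := (q m).[x] / x ^+ (m %/ r.+1).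
have vS m : (r <= m)%N -> v m.+1 = v m - gam m / x * v (m - r)%N.
  move=> rm; rewrite /v q_rec // hornerD hornerN hornerZ mulrDl mulNr.
  congr (_ - _); last by rewrite divS_sub // exprS invfM; ring.
  rewrite divnS //; case: ifP => _; last by rewrite add0n.
  by rewrite hornerM hornerX exprS; field; rewrite expf_neq0 ?gt_eqF.
have half m : (m < M)%N -> 0 < v m /\ v m <= 2 * v m.+1.
  elim/ltn_ind: m => m IH mM.
  have v0 : 0 < v m.
    case: m IH mM => [|m] IH mM.
      by rewrite /v q_init // hornerC div0n expr0 divr1 ltr01.
    by have [h1 h2] := IH m (ltnSn m) (ltnW mM); lra.
  split=> //; have [mr|rm] := ltnP m r.
    have v1 k : (k <= r)%N -> v k = 1.
      by move=> kr; rewrite /v q_init // hornerC divn_small // expr0 divr1.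
    by rewrite !v1 ?mulr1 ?ler1n // ltnW.
  rewrite vS //.
  (* Undoing [r] steps costs a factor [2^r]. With [gam m / x <= 2^-(r+1)] the subtracted term is
     then at most half of [v m], whence the constant [2^(r+1)]. *)
  have back k : (k <= r)%N -> v (m - k)%N <= 2 ^+ k * v m.
    elim: k => [|k IHk] kr; first by rewrite subn0 expr0 mul1r.
    have [|_] := IH (m - k.+1)%N _ (leq_ltn_trans (leq_subr _ _) mM).
      by rewrite ltn_subrL /= (leq_trans _ rm) // (leq_ltn_trans _ kr).
    rewrite (_ : (m - k.+1).+1 = m - k)%N; last by lia.
    by move=> /le_trans; apply; rewrite exprS -mulrA ler_pM2l // IHk // ltnW.
  have gx' : 2 ^+ r.+1 * gam m <= x by apply: gx; rewrite rm.
  have : gam m / x * v (m - r)%N <= gam m / x * (2 ^+ r * v m).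
    by rewrite ler_wpM2l ?back // divr_ge0 ?ltW ?gam_gt0.
  have : 2 * (gam m / x * (2 ^+ r * v m)) <= v m.
    rewrite (_ : _ * _ = (2 ^+ r.+1 * gam m / x) * v m); last by rewrite exprS;
      ring.
    by rewrite -[leRHS]mul1r ler_pM2r // ler_pdivrMr // mul1r.
  lra.
have : 0 < v M.
  case: M half {gx} => [|M] half.
    by rewrite /v q_init // hornerC div0n expr0 divr1 ltr01.
  by have [h1 h2] := half M (ltnSn M); lra.
by rewrite /v pmulr_lgt0 // invr_gt0 exprn_gt0.
Qed.

End Recurrence.

(** * Coefficients of the polynomials *)

Section FallingFactorial.
Variable R : realFieldType.
Implicit Types z : R.

Definition falling z n : R := \prod_(u < n) (z - u%:R).

Lemma falling0 z : falling z 0 = 1.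
Proof. by rewrite /falling big_ord0. Qed.

Lemma fallingSr z n : falling z n.+1 = falling z n * (z - n%:R).
Proof. by rewrite /falling big_ord_recr. Qed.

Lemma fallingSl z n : falling z n.+1 = z * falling (z - 1) n.
Proof.
rewrite /falling big_ord_recl /= subr0; congr (_ * _).
by apply: eq_bigr => i _; rewrite /bump leq0n natrD mulr1n; ring.
Qed.

Lemma falling_neq0 z n : n%:R - 1 < z -> falling z n != 0.
Proof.
move=> nz; apply/prodf_neq0 => u _; rewrite subr_eq0 gt_eqF //.
by apply: le_lt_trans nz; rewrite lerBrDr natr1 ler_nat.
Qed.

Lemma falling_nat_eq0 n k : (n < k)%N -> falling n%:R k = 0.
Proof. by move=> nk; rewrite /falling (bigD1 (Ordinal nk)) //= subrr mul0r. Qed.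

End FallingFactorial.

(** * One step of the recurrence, coefficient by coefficient *)

Section Recurrence_coefficients.
Variables (R : realFieldType) (n s : nat).
Implicit Types (A : 'I_n -> R) (B : 'I_s -> R).

(** The coefficient of [X^(N-l)] in a monic polynomial of degree [N]. Counting down from the top
    keeps [N] out of the formula. *)
Definition rev_coef A B l : R :=
  (-1) ^+ l / l`!%:R * (\prod_i falling (A i) l) / \prod_j falling (B j) l.

Lemma rev_coef0 A B : rev_coef A B 0 = 1.
Proof.
rewrite /rev_coef expr0 fact0 !big1 ?divr1 ?mulr1 // => i _; exact: falling0.
Qed.

(** The factor that the denominator parameter [j] contributes to [g_m]; [x] is the numerator
    parameter being raised, and [d] tells which denominator parameter is raised with it. *)
Definition step_weight (d : pred 'I_s) (x : R) B j : R :=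
  (if d j then (B j - x) / (B j + 1) else 1) / B j.

(** After removal of the common falling factorials, only the raised parameters [A] and [B] remain:
    [(A+1)/(B+1) - (A-l)/(B-l) = (l+1)(B-A) / ((B+1)(B-l))], or [(A+1) - (A-l) = l+1] if no
    denominator parameter is raised. The factor [l+1] turns [1/(l+1)!] into [1/l!]. *)
Lemma rev_coef_step A A0 A1 i0 B B0 B1 (d : pred 'I_s) l :
    (forall i, A1 i = A i + (i == i0)%:R) -> (forall i, A0 i = A1 i - 1) ->
    (forall j, B1 j = B j + (d j)%:R) -> (forall j, B0 j = B j - 1) ->
    (forall j j', d j -> d j' -> j = j') ->
    (forall j, falling (B j) l.+1 != 0) -> (forall j, falling (B1 j) l.+1 != 0) ->
  rev_coef A1 B1 l.+1 = rev_coef A B l.+1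
    - (\prod_(i | i != i0) A i) * (\prod_j step_weight d (A i0) B j)
      * rev_coef A0 B0 l.
Proof.
move=> EA1 EA0 EB1 EB0 d_uniq nzB nzB1.
pose PA := \prod_(i | i != i0) A i.
pose XA := \prod_(i | i != i0) falling (A i - 1) l.
have HA : \prod_i falling (A i) l.+1 = falling (A i0) l * (A i0 - l%:R) * (PA *
  XA).
  rewrite (bigD1 i0) //= fallingSr; congr (_ * _).
  by rewrite -big_split; apply: eq_bigr => i _; rewrite fallingSl.
have HA1 : \prod_i falling (A1 i) l.+1 = (A i0 + 1) * falling (A i0) l * (PA *
  XA).
  rewrite (bigD1 i0) //= fallingSl EA1 eqxx addrK; congr (_ * _).
  rewrite -big_split; apply: eq_bigr => i /negbTE ii0.
  by rewrite EA1 ii0 addr0 fallingSl.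
have HA0 : \prod_i falling (A0 i) l = falling (A i0) l * XA.
  rewrite (bigD1 i0) //= EA0 EA1 eqxx addrK; congr (_ * _).
  by apply: eq_bigr => i /negbTE ii0; rewrite EA0 EA1 ii0 addr0.
rewrite /rev_coef HA HA1 HA0 -/PA.
have nzf : (l`!%:R : R) != 0 by rewrite pnatr_eq0 -lt0n fact_gt0.
have nzl : (l%:R + 1 : R) != 0 by rewrite natr1 pnatr_eq0.
rewrite factS natrM exprS -natr1.
have [[j0 dj0]|nod] := pselect (exists j, d j); last first.
  have d0 j : d j = false by apply/negbTE/negP => dj; apply: nod; exists j.
  have -> : \prod_j falling (B1 j) l.+1 = \prod_j falling (B j) l.+1.
    by apply: eq_bigr => j _; rewrite EB1 d0 addr0.
  have HB : \prod_j falling (B j) l.+1 = \prod_j B j * \prod_j falling (B0 j) l.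
    by rewrite -big_split; apply: eq_bigr => j _; rewrite fallingSl EB0.
  have nzP : \prod_j falling (B j) l.+1 != 0 by apply/prodf_neq0 => j _.
  have -> : \prod_j step_weight d (A i0) B j = (\prod_j B j)^-1.
    by rewrite -prodfV; apply: eq_bigr => j _; rewrite /step_weight d0 mul1r.
  move: nzP; rewrite HB mulf_eq0 negb_or => /andP[nz1 nz2].
  by field; rewrite nz1 nz2 nzl nzf.
pose PB := \prod_(j | j != j0) B j.
pose YB := \prod_(j | j != j0) falling (B j - 1) l.
have dF j : j != j0 -> d j = false.
  by move=> jj0; apply/negbTE/negP => dj; rewrite (d_uniq j j0) ?eqxx in jj0.
have HB1 : \prod_j falling (B1 j) l.+1 = (B j0 + 1) * falling (B j0) l * (PB *
  YB).
  rewrite (bigD1 j0) //= fallingSl EB1 dj0 addrK; congr (_ * _).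
  rewrite -big_split; apply: eq_bigr => j jj0.
  by rewrite EB1 dF // addr0 fallingSl.
have HB : \prod_j falling (B j) l.+1 = B j0 * falling (B j0 - 1) l * (PB * YB).
  rewrite (bigD1 j0) //= fallingSl; congr (_ * _).
  by rewrite -big_split; apply: eq_bigr => j jj0; rewrite fallingSl.
have HB0 : \prod_j falling (B0 j) l = falling (B j0 - 1) l * YB.
  rewrite (bigD1 j0) //= EB0; congr (_ * _).
  by apply: eq_bigr => j jj0; rewrite EB0.
have HW : \prod_j step_weight d (A i0) B j =
    (B j0 - A i0) / (B j0 + 1) / B j0 / PB.
  rewrite (bigD1 j0) //= /step_weight dj0; congr (_ * _).
  by rewrite /PB -prodfV; apply: eq_bigr => j jj0; rewrite dF // mul1r.
have nzP : \prod_j falling (B j) l.+1 != 0 by apply/prodf_neq0 => j _.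
have nzP1 : \prod_j falling (B1 j) l.+1 != 0 by apply/prodf_neq0 => j _.
have tt : falling (B j0) l * (B j0 - l%:R) = B j0 * falling (B j0 - 1) l.
  by rewrite -fallingSr -fallingSl.
have nzt := nzB j0; rewrite fallingSr mulf_eq0 negb_or in nzt.
have [nzt1 nzt2] := andP nzt.
rewrite HB1 HB HB0 HW; rewrite HB -tt in nzP *; rewrite HB1 in nzP1.
move: nzP nzP1; rewrite !mulf_eq0 !negb_or.
move=> /andP[_ /andP[nzPB nzYB]] /andP[/andP[nzB0 _] _].
have nzb : B j0 != 0.
  by have := nzB j0; rewrite fallingSl mulf_eq0 negb_or => /andP[].
have -> : falling (B j0 - 1) l = falling (B j0) l * (B j0 - l%:R) / B j0.
  by rewrite tt mulrC mulrA mulVf // mul1r.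
by field; rewrite ?nzb ?nzPB ?nzYB ?nzB0 ?nzt1 ?nzt2 ?nzl ?nzf.
Qed.

End Recurrence_coefficients.

Lemma divn_shift d x : (0 < d)%N -> ((x + d) %/ d = (x %/ d).+1)%N.
Proof. by move=> d0; rewrite divnDr ?dvdnn // divnn d0 addn1. Qed.

(** * Parameters of the intermediate polynomials and positivity of the recurrence coefficients *)

Section ParameterSequences.
Variables (R : rcfType) (r s : nat).
Variables (lam : s.-tuple nat) (a : r.-tuple R) (b : s.-tuple R).
Hypothesis r_gt0 : (0 < r)%N.
Hypothesis lam_sorted : sorted ltn lam.
Hypothesis lam_bound : forall j : 'I_s, (1 <= tnth lam j <= r)%N.
Hypothesis a_gt0 : forall i : 'I_r, 0 < tnth a i.
Hypothesis b_gt0 : forall j : 'I_s, 0 < tnth b j.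
Hypothesis lt_ab : forall (i : 'I_r) (j : 'I_s),
  (i < tnth lam j)%N -> tnth a i < tnth b j.
Hypothesis lt_a1b : forall (i : 'I_r) (j : 'I_s),
  (tnth lam j <= i)%N -> tnth a i - 1 < tnth b j.

(** These count the raises of a parameter: numerators take turns with period [r+1], while
    denominator [j] is raised whenever [m] is congruent to [lam_j] modulo [r]. The offset [2r-1]
    serves to write [ceil((n - lam_j)/r) + 1] as a floor of naturals, [(n + 2r-1 - lam_j) %/ r]. *)
Definition num_shift (m i : nat) : nat := ((m + (r - i)) %/ r.+1)%N.
Definition den_shift (m : nat) (j : 'I_s) : nat :=
  ((m + (r.*2.-1 - tnth lam j)) %/ r)%N.

(* The list [a] is completed by [1], for the factor [n (n-1) ... (n-k+1)]
   coming from [(-n)_k]. The parameters of [q_m], [m = (r+1) n + p], are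
   [num_par m i - n + 1] and [den_par m j - n + 1]. *)
Definition num_par (m : nat) (i : 'I_r.+1) : R :=
  nth 1 a i + (num_shift m i)%:R - 1.
Definition den_par (m : nat) (j : 'I_s) : R :=
  tnth b j + (den_shift m j)%:R - 2.

Definition num_step (m : nat) : 'I_r.+1 := Ordinal (ltn_pmod m (ltn0Sn r)).
Definition den_step (m : nat) : pred 'I_s :=
  fun j => (r %| m + (r.*2 - tnth lam j))%N.

Lemma num_par_period m i : (r <= m)%N ->
  num_par (m - r) i = num_par m.+1 i - 1.
Proof.
move=> rm; rewrite /num_par /num_shift.
rewrite (_ : m.+1 + (r - i) = (m - r + (r - i)) + r.+1)%N; last by lia.
by rewrite divn_shift // -natr1; ring.
Qed.

Lemma den_par_period m j : (r <= m)%N -> den_par (m - r) j = den_par m j - 1.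
Proof.
move=> rm; rewrite /den_par /den_shift.
rewrite (_ : m + _ = (m - r + (r.*2.-1 - tnth lam j)) + r)%N; last by lia.
by rewrite divn_shift // -natr1; ring.
Qed.

Lemma num_parS m i : num_par m.+1 i = num_par m i + (i == num_step m)%:R.
Proof.
rewrite /num_par /num_shift addSn divnS // natrD.
rewrite (_ : (r.+1 %| (m + (r - i)).+1)%N = (i == num_step m)); first by ring.
have il : (i <= r)%N by rewrite -ltnS.
have lt : (m %% r.+1 < r.+1)%N by rewrite ltn_pmod.
apply/idP/eqP => [/dvdnP[k Ek]|->].
  apply: val_inj => /=; have Em := divn_eq m r.+1.
  set u := (m %/ r.+1)%N in Em; set p := (m %% r.+1)%N in Em lt *.
  have Et : ((p + (r - i)).+1 = (k - u) * r.+1)%N by rewrite mulnBl; lia.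
  have Ek1 : (k - u = 1)%N by nia.
  by move: Et; rewrite Ek1 mul1n; lia.
rewrite /= -addnS; have -> : ((r - m %% r.+1).+1 = r.+1 - m %% r.+1)%N by lia.
rewrite (_ : (m + _ = (m %/ r.+1).+1 * r.+1)%N) ?dvdn_mull //.
by rewrite {1}(divn_eq m r.+1) mulSn; lia.
Qed.

Lemma lam_le j : (tnth lam j <= r)%N.
Proof. by have /andP[] := lam_bound j. Qed.

Lemma den_parS m j : den_par m.+1 j = den_par m j + (den_step m j)%:R.
Proof.
rewrite /den_par /den_shift /den_step addSn divnS // natrD -addnS.
have -> : ((r.*2.-1 - tnth lam j).+1 = r.*2 - tnth lam j)%N.
  by have := lam_le j; lia.
by ring.
Qed.

Lemma lam_inj : injective (tnth lam).
Proof.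
apply/tuple_uniqP; apply: sorted_uniq lam_sorted; last exact: ltnn.
exact: ltn_trans.
Qed.

(** The [lam_j] are distinct and lie in [1..r], hence are distinct modulo [r]. *)
Lemma den_step_uniq m j j' : den_step m j -> den_step m j' -> j = j'.
Proof.
rewrite /den_step => dj dj'; apply: lam_inj.
have /andP[] := lam_bound j; have /andP[] := lam_bound j'.
wlog le : j j' dj dj' / (tnth lam j <= tnth lam j')%N.
  move=> W; case/orP: (leq_total (tnth lam j) (tnth lam j')) => le.
    exact: W.
  by move=> h1 h2 h3 h4; apply/esym; apply: (W j' j).
move=> l1 l2 l3 l4; apply/eqP; rewrite eqn_leq le /= leqNgt; apply/negP => lt.
have := dvdn_sub dj dj'.
rewrite (_ : (_ - _)%N = (tnth lam j' - tnth lam j)%N); last by lia.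
by move/dvdn_leq; lia.
Qed.

Lemma deg_decomp m : exists n p, [/\ m = (r.+1 * n + p)%N, (p <= r)%N,
  (m %/ r.+1)%N = n & nat_of_ord (num_step m) = p].
Proof.
exists (m %/ r.+1)%N, (m %% r.+1)%N; split=> //; first by rewrite mulnC -divn_eq.
by rewrite -ltnS ltn_pmod.
Qed.

Lemma nth_a_gt0 i : 0 < nth 1 a i.
Proof.
have [il|il] := ltnP i r; last by rewrite nth_default ?size_tuple // ltr01.
by rewrite -[X in nth _ _ X]/(nat_of_ord (Ordinal il)) -tnth_nth.
Qed.

Lemma num_par_ge m (i : 'I_r.+1) : nth 1 a i + (m %/ r.+1)%:R - 1 <= num_par m i.
Proof. by rewrite lerD2r lerD2l ler_nat leq_div2r // leq_addr. Qed.

Lemma num_par_gt0 m i : (r < m)%N -> 0 < num_par m i.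
Proof.
move=> rm; apply: lt_le_trans (num_par_ge m i).
have h : (1 <= m %/ r.+1)%N by rewrite divn_gt0.
have : (1 : R) <= (m %/ r.+1)%:R by rewrite -[1]/(1%:R) ler_nat.
by have := nth_a_gt0 i; lra.
Qed.

(** The bound fails at [m = r]: if [lam_j = r], the parameter is [b_j - 1] there. *)
Lemma den_par_ge m j : (r < m)%N ->
  tnth b j + (m.+1 %/ r.+1)%:R - 1 <= den_par m j.
Proof.
move=> rm; rewrite /den_par /den_shift.
suff : ((m.+1 %/ r.+1).+1 <= (m + (r.*2.-1 - tnth lam j)) %/ r)%N.
  by rewrite -(ler_nat R) -natr1; lra.
rewrite leq_divRL //.
have := lam_le j; have : (r.+1 <= m)%N by [].
have := leq_trunc_div m.+1 r.+1.
have : (1 <= m.+1 %/ r.+1)%N by rewrite divn_gt0 // ltnS ltnW.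
set N := (m.+1 %/ r.+1)%N; nia.
Qed.

Lemma den_par_gt0 m j : (r < m)%N -> 0 < den_par m j.
Proof.
move=> rm; apply: lt_le_trans (den_par_ge j rm).
have h : (1 <= m.+1 %/ r.+1)%N by rewrite divn_gt0 // ltnS ltnW.
have : (1 : R) <= (m.+1 %/ r.+1)%:R by rewrite -[1]/(1%:R) ler_nat.
by have := b_gt0 j; lra.
Qed.

Lemma falling_den_neq0 m j l : (r < m)%N -> (l <= m.+1 %/ r.+1)%N ->
  falling (den_par m j) l != 0.
Proof.
move=> rm lN; apply: falling_neq0; apply: lt_le_trans (den_par_ge j rm).
have : (l%:R : R) <= (m.+1 %/ r.+1)%:R by rewrite ler_nat.
by have := b_gt0 j; lra.
Qed.

(** Write [m = (r+1) n + p]; the raised numerator is [a_p + n - 1] with [p] 0-based. If [p < lam_j],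
    the denominator is at least [b_j + n - 1], and [a_p < b_j] concludes. If [p >= lam_j], it is at
    least [b_j + n], and [a_p - 1 < b_j] is enough; for [p = r] the completing parameter 1 takes the
    place of [a_p], and [b_j > 0] is enough. *)
Lemma den_step_gap m j : (r < m)%N -> den_step m j ->
  num_par m (num_step m) < den_par m j.
Proof.
move=> rm /dvdnP[t Et].
have [n [p [Em pr En Ep]]] := deg_decomp m.
have /andP[l1 lr] := lam_bound j.
have n1 : (1 <= n)%N by rewrite -En divn_gt0.
have -> : num_par m (num_step m) = nth 1 a p + n%:R - 1.
  rewrite /num_par /num_shift Ep; congr (_ + _%:R - _).
  rewrite Em -addnA subnKC // mulnC divnMDl // divn_small // addn0 //.
have Et1 : den_shift m j = t.-1.
  rewrite /den_shift; have -> : (m + (r.*2.-1 - tnth lam j) = (t * r).-1)%N by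
    lia.
  have t0 : (0 < t)%N by rewrite lt0n; apply: contra_eq_neq Et => ->; lia.
  rewrite -{1}(prednK t0) mulSn -{1}(prednK r_gt0) addSn /= addnC.
  by rewrite divnMDl // divn_small ?addn0 // prednK.
rewrite /den_par Et1.
have [pl|lp] := ltnP p (tnth lam j).
  have tn : (n.+1 <= t.-1)%N by nia.
  have pr' : (p < r)%N := leq_trans pl lr.
  have /lt_ab : (Ordinal pr' < tnth lam j)%N by [].
  rewrite (tnth_nth 1) /=; move: tn; rewrite -(ler_nat R) -natr1.
  by lra.
have tn : (n.+2 <= t.-1)%N.
  suff : (n.+3 <= t)%N by lia.
  by nia.
move: tn; rewrite -(ler_nat R) -2!natr1.
have [pr'|rp] := ltnP p r.
  have /lt_a1b : (tnth lam j <= Ordinal pr')%N by [].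
  by rewrite (tnth_nth 1) /=; lra.
rewrite nth_default ?size_tuple //.
by have := b_gt0 j; lra.
Qed.

Definition weight m j : R := step_weight (den_step m) (num_par m (num_step m))
  (den_par m) j.

(** The case [m = r] is set apart because the general quotient can degenerate there: if [lam_j = r],
    the denominator parameter is [B = b_j - 1], the raised numerator is 0, and
    [(B - 0) / (B + 1) / B] should read [1 / b_j] even when [B = 0]. *)
Definition gam m : R :=
  if m == r then (\prod_i tnth a i) * \prod_j (tnth b j)^-1
  else (\prod_(i | i != num_step m) num_par m i) * \prod_j weight m j.

Lemma weight_gt0 m j : (r < m)%N -> 0 < weight m j.
Proof.
move=> rm; have B0 := den_par_gt0 j rm; rewrite /weight /step_weight divr_gt0 //.
case: ifP => // dj; rewrite divr_gt0 ?subr_gt0 ?den_step_gap //.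
by rewrite ltr_wpDr.
Qed.

Lemma gam_gt0 m : (r <= m)%N -> 0 < gam m.
Proof.
rewrite leq_eqVlt /gam eq_sym => /orP[/eqP ->|rm].
  by rewrite eqxx mulr_gt0 // prodr_gt0 // => i _; rewrite ?invr_gt0.
rewrite gtn_eqF // mulr_gt0 // prodr_gt0 // => i _; first exact: num_par_gt0.
exact: weight_gt0.
Qed.

Definition rec_poly m : {poly R} :=
  \poly_(k < (m %/ r.+1).+1)
    rev_coef (num_par m) (den_par m) (m %/ r.+1 - k).

Lemma rec_poly_init m : (m <= r)%N -> rec_poly m = 1.
Proof.
move=> mr; rewrite /rec_poly divn_small //; apply/polyP => k.
by rewrite coef_poly coef1; case: k => //=; rewrite rev_coef0.
Qed.

Lemma rec_poly_rec_base : rec_poly r.+1 = 'X * rec_poly r - gam r *: rec_poly 0.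
Proof.
rewrite (rec_poly_init (leqnn r)) (rec_poly_init (leq0n r)) mulr1 alg_polyC
  /gam eqxx.
rewrite /rec_poly divnn /=; apply/polyP => k; rewrite coef_poly coefB coefX coefC.
case: k => [|[|k]] /=; [|by rewrite subnn rev_coef0 subr0|by rewrite subr0].
rewrite sub0r /rev_coef expr1 divr1 mulN1r mulNr; congr (- (_ * _)).
  rewrite big_ord_recr /= /falling big_ord_recl big_ord0 mulr1 subr0.
  rewrite /num_par /num_shift subnn addn0 divnn /= nth_default ?size_tuple //.
  rewrite [X in _ * X](_ : _ = 1); last by ring.
  rewrite mulr1; apply: eq_bigr => i _.
  rewrite big_ord_recl big_ord0 mulr1 subr0 divnDl ?dvdnn // divnn /=.
  by rewrite divn_small ?ltnS ?leq_subr // (tnth_nth 1); ring.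
rewrite -prodfV; apply: eq_bigr => j _; congr (_^-1).
rewrite /falling big_ord_recl big_ord0 mulr1 subr0 /den_par /den_shift.
have -> : ((r.+1 + (r.*2.-1 - tnth lam j)) %/ r = 2)%N; last by ring.
have /andP[l1 lr] := lam_bound j.
rewrite (_ : (_ + _)%N = 2 * r + (r - tnth lam j))%N; last by lia.
by rewrite divnMDl // divn_small ?addn0 // ltn_subrL l1.
Qed.

Lemma rec_poly_rec m : (r <= m)%N ->
  rec_poly m.+1 = (if (r.+1 %| m.+1)%N then 'X * rec_poly m else rec_poly m)
    - gam m *: rec_poly (m - r).
Proof.
rewrite leq_eqVlt => /orP[/eqP <-|rm].
  by rewrite dvdnn subnn rec_poly_rec_base.
have rm' := ltnW rm.
have step l : (l.+1 <= m.+1 %/ r.+1)%N ->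
    rev_coef (num_par m.+1) (den_par m.+1) l.+1 =
    rev_coef (num_par m) (den_par m) l.+1
    - gam m * rev_coef (num_par (m - r)) (den_par (m - r)) l.
  move=> lN; rewrite (rev_coef_step (A := num_par m) (A0 := num_par (m - r))
    (B := den_par m) (B0 := den_par (m - r)) (i0 := num_step m)
    (d := den_step m)).
  - by rewrite /gam gtn_eqF.
  - by move=> i; rewrite num_parS.
  - by move=> i; rewrite num_par_period.
  - by move=> j; rewrite den_parS.
  - by move=> j; rewrite den_par_period.
  - exact: den_step_uniq.
  - by move=> j; apply: falling_den_neq0.
  - move=> j; apply: falling_den_neq0; first exact: ltnW.
    by rewrite (leq_trans lN) // leq_div2r.
have E1 : (m.+1 %/ r.+1 = ((m - r) %/ r.+1).+1)%N by exact: divS_sub.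
have E2 := divnS m (ltn0Sn r).
apply/polyP => k; rewrite /rec_poly coefB coefZ.
rewrite [LHS]coef_poly [in X in _ - X]coef_poly.
set D := ((m - r) %/ r.+1)%N in E1 *; set N := (m.+1 %/ r.+1)%N in E1 E2 step *.
have lhs : (if (k < N.+1)%N then rev_coef (num_par m.+1) (den_par m.+1) (N - k)
  else 0)
    = (if (k < N.+1)%N then rev_coef (num_par m) (den_par m) (N - k) else 0)
    - gam m * (if (k < D.+1)%N then rev_coef (num_par (m - r)) (den_par (m -
      r)) (D - k) else 0).
  case: ifP => kN; last first.
    by rewrite (_ : (k < D.+1)%N = false) ?mulr0 ?subr0 //; apply/negbTE; lia.
  have [kD|Dk] := leqP k D.
    rewrite ltnS kD; have -> : (N - k = (D - k).+1)%N by lia.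
    by rewrite step // -/N; lia.
  rewrite (_ : (k < D.+1)%N = false); last by apply/negbTE; lia.
  by rewrite (_ : (N - k)%N = 0)%N ?rev_coef0 ?mulr0 ?subr0 //; lia.
rewrite {}lhs; congr (_ - _).
case: (boolP (r.+1 %| m.+1)%N) => dv; last first.
  by rewrite (negbTE dv) add0n in E2; rewrite coef_poly -E2.
rewrite dv add1n in E2; rewrite coefXM coef_poly.
have EN : (m %/ r.+1 = N.-1)%N by rewrite E2.
(* For the constant coefficient: the completing parameter of [q_m] equals [N-1], so its falling
   factorial of length [N] vanishes, in agreement with ['X * q_m]. *)
rewrite EN; case: k => [|k] /=.
  rewrite /rev_coef subn0 (_ : \prod_i _ = 0) ?mulr0 ?mul0r //.
  rewrite (bigD1 ord_max) //= /num_par nth_default ?size_tuple //.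
  rewrite /num_shift subnn addn0 EN [1 + _]addrC addrK.
  by rewrite falling_nat_eq0 ?mul0r // E2.
by rewrite ltnS E2 /= subSS ltnS.
Qed.

End ParameterSequences.

(** * Upper bound for the recurrence coefficients *)

(** Each [w_j] cancels the factor [F (kappa j)]; the [r-s] factors left over account for the
    exponent. *)
Lemma prod_paired_le (R : realFieldType) (r s : nat) (F : 'I_r -> R)
    (w : 'I_s -> R) (kappa : 'I_s -> 'I_r) (X : R) :
    injective kappa -> (forall i, 0 <= F i <= X) -> (forall j, 0 <= w j) ->
    (forall j, F (kappa j) * w j <= 1) ->
  (\prod_i F i) * \prod_j w j <= X ^+ (r - s).
Proof.
move=> kinj FX w0 Fw; pose S := [set kappa j | j in 'I_s].
have cS : #|S| = s by rewrite card_imset // card_ord.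
rewrite (bigID (mem S)) /= mulrAC -[leRHS]mul1r.
apply: ler_pM.
- by rewrite mulr_ge0 // prodr_ge0 // => i _; have /andP[] := FX i.
- by rewrite prodr_ge0 // => i _; have /andP[] := FX i.
- rewrite big_imset /=; last by move=> i j _ _; exact: kinj.
  rewrite -big_split /=; apply: prodr_ile1 => j _.
  by rewrite Fw mulr_ge0 //; have /andP[] := FX (kappa j).
- apply: le_trans (_ : \prod_(i | i \notin S) X <= _).
    by apply: ler_prod => i _.
  rewrite prodr_const (_ : #|_| = (r - s)%N) //.
  have := cardC (mem S); rewrite card_ord cS => /(congr1 (subn^~ s)) /=.
  by rewrite addKn => <-; apply: eq_card => i; rewrite !inE.
Qed.

Section Bound.
Variables (R : rcfType) (r s : nat).
Variables (lam : s.-tuple nat) (a : r.-tuple R) (b : s.-tuple R).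
Hypothesis r_gt0 : (0 < r)%N.
Hypothesis lam_sorted : sorted ltn lam.
Hypothesis lam_bound : forall j : 'I_s, (1 <= tnth lam j <= r)%N.
Hypothesis a_gt0 : forall i : 'I_r, 0 < tnth a i.
Hypothesis b_gt0 : forall j : 'I_s, 0 < tnth b j.
Hypothesis lt_ab : forall (i : 'I_r) (j : 'I_s),
  (i < tnth lam j)%N -> tnth a i < tnth b j.
Hypothesis lt_a1b : forall (i : 'I_r) (j : 'I_s),
  (tnth lam j <= i)%N -> tnth a i - 1 < tnth b j.

Let lamP_lt j : ((tnth lam j).-1 < r)%N.
Proof. by have /andP[l1 lr] := lam_bound j; rewrite prednK. Qed.

(** The numerator paired with [b_j]: the last index for which [a_i < b_j] is assumed. *)
Definition lam_ord j : 'I_r := Ordinal (lamP_lt j).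

Lemma lam_ord_inj : injective lam_ord.
Proof.
move=> i j /(congr1 val) /= E; apply: (lam_inj lam_sorted).
have /andP[l1 _] := lam_bound i; have /andP[l2 _] := lam_bound j.
by rewrite -(prednK l1) -(prednK l2) E.
Qed.

Lemma lt_a_lam_ord j : tnth a (lam_ord j) < tnth b j.
Proof.
by apply: lt_ab; rewrite /=; have /andP[l1 lr] := lam_bound j; rewrite prednK.
Qed.

Local Notation A := (num_par a).
Local Notation B := (den_par r lam b).
Local Notation G := (gam lam a b).
Local Notation W := (weight lam a b).

Lemma num_le_den m j : (r < m)%N -> A m (widen_ord (leqnSn r) (lam_ord j)) <= B
  m j.
Proof.
move=> rm; rewrite /num_par /den_par /=.
rewrite -[X in nth _ _ X]/(nat_of_ord (lam_ord j)) -tnth_nth.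
have ab := lt_a_lam_ord j.
suff : (num_shift r m (tnth lam j).-1 < den_shift r lam m j)%N.
  by rewrite -(ler_nat R) -natr1; lra.
rewrite /num_shift /den_shift leq_divRL //.
have /andP[l1 lr] := lam_bound j.
have := leq_trunc_div (m + (r - (tnth lam j).-1)) r.+1.
have : ((m + (r - (tnth lam j).-1)) %/ r.+1 = 1 \/ 1 <
   (m + (r - (tnth lam j).-1)) %/ r.+1)%N.
  have : (0 < (m + (r - (tnth lam j).-1)) %/ r.+1)%N.
    by rewrite divn_gt0 // (leq_trans rm) // leq_addr.
  lia.
by set Y := (_ %/ _)%N => -[->|Y1]; nia.
Qed.

Lemma weight_le m j x : (r < m)%N -> 0 <= x -> x <= B m j -> x * W m j <= 1.
Proof.
move=> rm x0 xB; have B0 := den_par_gt0 r_gt0 lam_sorted lam_bound b_gt0 j rm.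
rewrite /weight /step_weight mulrA ler_pdivrMr // mul1r.
case: ifP => dj; last by rewrite mulr1.
have A0 := num_par_gt0 a_gt0 (num_step r m) rm.
rewrite mulrA ler_pdivrMr; last by rewrite ltr_wpDr.
by nra.
Qed.

(** When the numerator paired with [j] is the one omitted from [g_m], the completing parameter [n]
    replaces it. For [n >= 2] it lies below the denominator parameter. For [n = 1] that parameter is
    [b_j], possibly less than 1; but then it is raised at this very step, and the numerator
    [b_j - A] of its weight makes up for it. *)
Lemma weight_le_last m j : (r < m)%N -> (tnth lam j).-1 = num_step r m ->
  A m ord_max * W m j <= 1.
Proof.
move=> rm Ej; have A0 := num_par_gt0 a_gt0 (num_step r m) rm.
have B0 := den_par_gt0 r_gt0 lam_sorted lam_bound b_gt0 j rm.
have [n [p [Em pr En Ep]]] := deg_decomp r m.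
have /andP[l1 lr] := lam_bound j.
have n1 : (1 <= n)%N by rewrite -En divn_gt0.
have -> : A m ord_max = n%:R.
  rewrite /num_par /num_shift nth_default ?size_tuple //= subnn addn0 En; ring.
have bj := b_gt0 j.
have [nn1|n2] := leqP n 1; last first.
  apply: weight_le => //; rewrite /den_par.
  suff : (n.+2 <= den_shift r lam m j)%N by rewrite -(ler_nat R) -2!natr1; lra.
  by rewrite /den_shift leq_divRL //; nia.
have {n1 nn1} n1 : n = 1%N by lia.
have dj : den_step r lam m j.
  rewrite /den_step (_ : (_ + _)%N = 3 * r)%N ?dvdn_mull //; nia.
have EB : B m j = tnth b j.
  rewrite /den_par /den_shift.
  rewrite (_ : (_ + _)%N = 2 * r + r.-1)%N; last by nia.
  by rewrite divnMDl // divn_small ?addn0 ?prednK //; ring.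
rewrite /weight /step_weight dj EB n1 mul1r.
rewrite ler_pdivrMr // mul1r ler_pdivrMr ?ltr_wpDr //.
by nra.
Qed.

(** The completing parameter is moved into the slot of the omitted factor, so that the product runs
    over ['I_r] and the pairing by [lam_ord] applies. *)
Lemma prod_num_step (F : 'I_r.+1 -> R) (p : 'I_r.+1) :
  \prod_(i | i != p) F i =
  \prod_(i < r) F (if nat_of_ord i == p then ord_max else widen_ord (leqnSn r) i).
Proof.
have [/eqP pr|pr] := boolP (nat_of_ord p == r).
  rewrite big_mkcond big_ord_recr /= (_ : (ord_max != p) = false) ?mulr1;
    last first.
    by apply/negbTE/negPn/eqP/val_inj; rewrite /= pr.
  apply: eq_bigr => i _; rewrite ltn_eqF ?pr //.
  by rewrite ifT // -val_eqE /= pr ltn_eqF.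
have pr' : (p < r)%N by rewrite ltn_neqAle pr -ltnS ltn_ord.
pose p' := Ordinal pr'.
rewrite (bigD1 p') //= eqxx big_mkcond big_ord_recr /= ifT; last first.
  by rewrite -val_eqE /= eq_sym.
rewrite mulrC; congr (_ * _); rewrite [RHS]big_mkcond.
apply: eq_bigr => i _ /=; rewrite -val_eqE /= -(val_eqE i p') /=.
by case: eqP.
Qed.

Lemma gam_le m X : (r <= m)%N ->
  (forall i : 'I_r, tnth a i <= X) -> ((r < m)%N -> forall i, A m i <= X) ->
  G m <= X ^+ (r - s).
Proof.
move=> rm aX AX; rewrite /gam; case: eqP => [_|/eqP mr].
  apply: (prod_paired_le (kappa := lam_ord) lam_ord_inj) => [i|j|j].
  - by rewrite (ltW (a_gt0 i)) aX.
  - by rewrite invr_ge0 ltW.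
  - by rewrite ler_pdivrMr // mul1r ltW // lt_a_lam_ord.
have {mr}rm : (r < m)%N by rewrite ltn_neqAle eq_sym mr.
rewrite prod_num_step.
apply: (prod_paired_le (kappa := lam_ord) lam_ord_inj) => [i|j|j].
- by rewrite AX // ltW // num_par_gt0.
- by rewrite ltW // weight_gt0.
- case: ifP => [/eqP Ej|_]; first exact: weight_le_last.
  by apply: weight_le => //; [rewrite ltW // num_par_gt0|exact: num_le_den].
Qed.

Lemma num_par_le m i n al : (m < r.+1 * n)%N -> (forall i, nth 1 a i <= al) ->
  A m i <= n%:R + al.
Proof.
move=> mn aal; rewrite /num_par /num_shift.
have : ((m + (r - i)) %/ r.+1 <= n.+1)%N.
  rewrite -ltnS ltn_divLR // mulnC !mulnS; lia.
rewrite -(ler_nat R) -natr1; have := aal i; lra.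
Qed.

End Bound.

Local Open Scope classical_set_scope.
Local Open Scope ring_scope.

(** * Locally uniform limits of polynomials *)

Section DominatedSequences.
Variable R : realType.
Implicit Types (C M x B : R) (c u : nat -> R) (p : nat -> {poly R}).

(** This shape of bound survives differentiation and translation without change of [M], because
    ['C(i+k, i) M^(i+k) / (i+k)! = (M^i / i!) (M^k / k!)]. *)
Definition exp_bounded C M u := forall k, `|u k| <= C * (M ^+ k / k`!%:R).

Definition dominated C M p := forall n, exp_bounded C M (fun k => (p n)`_k).

Definition coef_cvg p c := forall k, (p n)`_k @[n --> \oo] --> c k.

Definition power_sum c x : R := limn (series (fun k => c k * x ^+ k)).

Lemma exp_bounded_lim C M p c :
  dominated C M p -> coef_cvg p c -> exp_bounded C M c.
Proof.
move=> dp cp k; apply: (cvgr_to_le (cvg_norm (cp k))).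
by near=> n; exact: dp.
Unshelve. all: by end_near. Qed.

Lemma exp_bounded_ge0 C M u : exp_bounded C M u -> 0 <= C.
Proof.
move=> /(_ 0%N); rewrite expr0 fact0 divr1 mulr1; exact: le_trans.
Qed.

Lemma series_exp_cvg x C :
  series (fun k => C * (x ^+ k / k`!%:R)) @ \oo --> C * expR x.
Proof.
rewrite (_ : series _ = fun n => C * series (exp_coeff x) n).
  by apply: cvgM; [exact: cvg_cst|exact: is_cvg_series_exp_coeff].
by apply/funext => n; rewrite /series /= -mulr_sumr.
Qed.

Lemma exp_bounded_term C M u x k : 0 <= M -> exp_bounded C M u ->
  `|u k * x ^+ k| <= C * ((M * `|x|) ^+ k / k`!%:R).
Proof.
move=> M0 bu; rewrite normrM normrX exprMn.
rewrite (_ : C * _ = C * (M ^+ k / k`!%:R) * `|x| ^+ k); last by ring.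
by rewrite ler_wpM2r // exprn_ge0.
Qed.

Lemma exp_bounded_series C M u x n m : 0 <= M -> exp_bounded C M u ->
  (n <= m)%N ->
  `|series (fun k => u k * x ^+ k) m - series (fun k => u k * x ^+ k) n| <=
  C * expR (M * `|x|) - series (fun k => C * ((M * `|x|) ^+ k / k`!%:R)) n.
Proof.
move=> M0 bu nm; set E := fun k => C * _.
have E0 k : 0 <= E k.
  by rewrite mulr_ge0 ?(exp_bounded_ge0 bu) // divr_ge0 // exprn_ge0 // mulr_ge0.
have Ec := @series_exp_cvg (M * `|x|) C.
have le_m : series E m <= C * expR (M * `|x|).
  rewrite -(cvg_lim (@Rhausdorff R) Ec); apply: nondecreasing_cvgn_le.
    by apply: nondecreasing_series => k _ _; exact: E0.
  by apply/cvg_ex; exists (C * expR (M * `|x|)).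
apply: le_trans (lerB le_m (lexx _)).
rewrite !sub_series_geq //; apply: le_trans (ler_norm_sum _ _ _) _.
by apply: ler_sum => k _; exact: exp_bounded_term.
Qed.

Lemma power_sum_cvg C M u x : 0 <= M -> exp_bounded C M u ->
  series (fun k => u k * x ^+ k) @ \oo --> power_sum u x.
Proof.
move=> M0 bu; apply: normed_cvg.
apply: (@series_le_cvg _ (fun k => `|u k * x ^+ k|)
  (fun k => C * ((M * `|x|) ^+ k / k`!%:R))) => //.
- by move=> k; apply: le_trans (normr_ge0 _) (exp_bounded_term x k M0 bu).
- by move=> k; exact: exp_bounded_term.
- by apply/cvg_ex; exists (C * expR (M * `|x|)); exact: series_exp_cvg.
Qed.

Lemma power_sum_tail C M u x n : 0 <= M -> exp_bounded C M u ->
  `|power_sum u x - series (fun k => u k * x ^+ k) n| <=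
  C * expR (M * `|x|) - series (fun k => C * ((M * `|x|) ^+ k / k`!%:R)) n.
Proof.
move=> M0 bu.
have /cvg_norm h : series (fun k => u k * x ^+ k) m
    - series (fun k => u k * x ^+ k) n @[m --> \oo] -->
    power_sum u x - series (fun k => u k * x ^+ k) n.
  by apply: cvgB; [exact: power_sum_cvg bu|exact: cvg_cst].
apply: (cvgr_to_le h); near=> m; apply: exp_bounded_series => //.
by near: m; exact: nbhs_infty_ge.
Unshelve. all: by end_near. Qed.

Lemma horner_series (q : {poly R}) x n : (size q <= n)%N ->
  q.[x] = series (fun k => q`_k * x ^+ k) n.
Proof.
by move=> sn; rewrite (horner_coef_wide _ sn) /series /= big_mkord.
Qed.

Lemma power_sum_poly (q : {poly R}) x : power_sum (fun k => q`_k) x = q.[x].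
Proof.
apply: (cvg_lim (@Rhausdorff R)); apply: cvg_near_cst.
near=> n; apply/esym/horner_series.
by near: n; exact: nbhs_infty_ge.
Unshelve. all: by end_near. Qed.

Lemma power_sum_bound C M u x : 0 <= M -> exp_bounded C M u ->
  `|power_sum u x| <= C * expR (M * `|x|).
Proof.
move=> M0 bu; have := power_sum_tail x 0 M0 bu.
by rewrite /series /= !big_geq // !subr0.
Qed.

Lemma horner_bound C M p x n : 0 <= M -> dominated C M p ->
  `|(p n).[x]| <= C * expR (M * `|x|).
Proof.
by move=> M0 dp; rewrite -power_sum_poly; exact: power_sum_bound (dp n).
Qed.

(** Past an index [N] the tails of all [p n] and of the limit are at most the tail of [C exp(M B)],
    hence at most [e/3]; before [N] there are finitely many convergent coefficients. *)
Lemma horner_unif_cvg C M p c B (e : R) : 0 <= M ->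
    dominated C M p -> coef_cvg p c -> 0 < e ->
  \forall n \near \oo, forall x, `|x| <= B ->
    `|(p n).[x] - power_sum c x| <= e.
Proof.
move=> M0 dp cp e0.
have bc := exp_bounded_lim dp cp.
have C0 := exp_bounded_ge0 bc.
have e30 : 0 < e / 3 by lra.
have [N] : exists N, C * expR (M * B) - series (fun k => C * ((M * B) ^+ k /
  k`!%:R)) N <= e / 3.
  have := @series_exp_cvg (M * B) C.
  move=> /cvgrPdist_le/(_ _ e30)[N _ NP]; exists N.
  by apply: le_trans (ler_norm _) (NP N _); rewrite /= leqnn.
(* The tails of the exponential series grow with the argument, being limits of sums of nonnegative
   terms; thus [B] is the worst case. *)
have tail_le x : `|x| <= B ->
    C * expR (M * `|x|) - series (fun k => C * ((M * `|x|) ^+ k / k`!%:R)) N <=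
    C * expR (M * B) - series (fun k => C * ((M * B) ^+ k / k`!%:R)) N.
  move=> xB; have B0 : 0 <= B := le_trans (normr_ge0 x) xB.
  have h y : C * expR y - series (fun k => C * (y ^+ k / k`!%:R)) N =
      limn (fun m => series (fun k => C * (y ^+ k / k`!%:R)) m
        - series (fun k => C * (y ^+ k / k`!%:R)) N).
    apply/esym/(cvg_lim (@Rhausdorff R)); apply: cvgB; last exact: cvg_cst.
    exact: series_exp_cvg.
  have ch y : cvgn (fun m => series (fun k => C * (y ^+ k / k`!%:R)) m
        - series (fun k => C * (y ^+ k / k`!%:R)) N).
    apply/cvg_ex; exists (C * expR y - series (fun k => C * (y ^+ k / k`!%:R)) N).
    by apply: cvgB; [exact: series_exp_cvg|exact: cvg_cst].
  rewrite !h; apply: ler_lim => //; near=> m.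
  have Nm : (N <= m)%N by near: m; exact: nbhs_infty_ge.
  rewrite !sub_series_geq //; apply: ler_sum => k _.
  rewrite ler_wpM2l // ler_wpM2r // lerXn2r ?nnegrE ?mulr_ge0 //.
  by rewrite ler_wpM2l.
move=> NP.
have mid : \forall n \near \oo, \sum_(k < N) `|(p n)`_k - c k| * B ^+ k <= e / 3.
  have : (\sum_(k < N) `|(p n)`_k - c k| * B ^+ k) @[n --> \oo] --> (0 : R).
    elim: (N) => [|K IHK].
      rewrite (_ : (fun n => _) = fun=> 0); first exact: cvg_cst.
      by apply/funext => n; rewrite big_ord0.
    rewrite (_ : (fun n => _) = fun n => \sum_(k < K) `|(p n)`_k - c k| * B ^+ k
       + `|(p n)`_K - c K| * B ^+ K); last first.
      by apply/funext => n; rewrite big_ord_recr.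
    have hK : (p n)`_K - c K @[n --> \oo] --> c K - c K.
      by apply: cvgB; [exact: cp|exact: cvg_cst].
    have := cvgD IHK (cvgM (cvg_norm hK) (cvg_cst (B ^+ K))).
    by rewrite subrr normr0 mul0r addr0; apply.
  move=> /cvgrPdist_le/(_ _ e30); apply: filterS => n.
  by rewrite sub0r normrN; apply: le_trans; exact: ler_norm.
apply: filterS mid => n mid x xB.
have t1 : `|(p n).[x] - series (fun k => (p n)`_k * x ^+ k) N| <= e / 3.
  rewrite -power_sum_poly; apply: le_trans (power_sum_tail _ _ M0 (dp n)) _.
  exact: le_trans (tail_le x xB) NP.
have t2 : `|power_sum c x - series (fun k => c k * x ^+ k) N| <= e / 3.
  apply: le_trans (power_sum_tail _ _ M0 bc) _.
  exact: le_trans (tail_le x xB) NP.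
have t3 : `|series (fun k => (p n)`_k * x ^+ k) N
    - series (fun k => c k * x ^+ k) N| <= e / 3.
  rewrite /series /= !big_mkord -sumrB.
  apply: le_trans (ler_norm_sum _ _ _) _; apply: le_trans mid.
  apply: ler_sum => k _; rewrite -mulrBl normrM normrX ler_wpM2l //.
  by rewrite lerXn2r // nnegrE (le_trans (normr_ge0 x)).
set P := (p n).[x] in t1 *; set S := series _ _ in t1 t3 *.
set T := series _ _ in t3 t2 *; set F := power_sum c x in t2 *.
have -> : P - F = (P - S) + (S - T) + (T - F) by ring.
apply: le_trans (ler_normD _ _) _; rewrite [e](_ : _ = e / 3 + e / 3 + e / 3);
  last by lra.
rewrite lerD // ?[`|T - _|]distrC //.
by apply: le_trans (ler_normD _ _) _; rewrite lerD.
Unshelve. all: by end_near. Qed.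

Lemma horner_cvg C M p c x : 0 <= M -> dominated C M p -> coef_cvg p c ->
  (p n).[x] @[n --> \oo] --> power_sum c x.
Proof.
move=> M0 dp cp; apply/cvgrPdist_le => e e0.
apply: filterS (horner_unif_cvg `|x| M0 dp cp e0) => n /(_ x (lexx _)).
by rewrite distrC.
Qed.

Lemma nderivn_dominated C M p i : 0 <= M -> dominated C M p ->
  dominated (C * (M ^+ i / i`!%:R)) M (fun n => (p n)^`N(i)).
Proof.
move=> M0 dp n k; rewrite coef_nderivn -[X in `|X|]mulr_natr normrM (ger0_norm
  (ler0n _ _)).
apply: le_trans (ler_wpM2r (ler0n _ _) (dp n _)) _.
rewrite le_eqVlt; apply/orP; left; apply/eqP.
have := bin_fact (leq_addr k i); rewrite addKn => /(congr1 (fun j : nat => j%:R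
  : R)).
rewrite !natrM => <-; rewrite exprD.
have f0 j : (j`!%:R : R) != 0 by rewrite pnatr_eq0 -lt0n fact_gt0.
have b0 : ('C(i + k, i)%:R : R) != 0 by rewrite pnatr_eq0 -lt0n bin_gt0 leq_addr.
by field; rewrite !f0 b0.
Qed.

Definition nderiv_seq (i : nat) c k : R := c (i + k)%N *+ 'C(i + k, i).

Lemma nderivn_coef_cvg p c i : coef_cvg p c ->
  coef_cvg (fun n => (p n)^`N(i)) (nderiv_seq i c).
Proof.
move=> cp k; rewrite /nderiv_seq -mulr_natr.
rewrite (_ : (fun n => _) = fun n => (p n)`_(i + k) * 'C(i + k, i)%:R).
  by apply: cvgM; [exact: cp|exact: cvg_cst].
by apply/funext => n; rewrite coef_nderivn mulr_natr.
Qed.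

Lemma nderiv_seq0 c : nderiv_seq 0 c = c.
Proof. by apply/funext => k; rewrite /nderiv_seq add0n bin0 mulr1n. Qed.

Definition taylor x (q : {poly R}) : {poly R} :=
  \poly_(i < size q) (q^`N(i)).[x].

Lemma horner_taylor x t (q : {poly R}) : (taylor x q).[t] = q.[x + t].
Proof. by rewrite horner_poly nderiv_taylor //; exact: mulrC. Qed.

Lemma coef_taylor x (q : {poly R}) i : (taylor x q)`_i = (q^`N(i)).[x].
Proof.
by rewrite coef_poly; case: ltnP => // si; rewrite nderivn_poly0 // horner0.
Qed.

Lemma taylor_dominated C M p x : 0 <= M -> dominated C M p ->
  dominated (C * expR (M * `|x|)) M (fun n => taylor x (p n)).
Proof.
move=> M0 dp n i; rewrite coef_taylor.
apply: le_trans (horner_bound x n M0 (nderivn_dominated i M0 dp)) _.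
by rewrite mulrAC.
Qed.

Lemma taylor_coef_cvg C M p c x : 0 <= M -> dominated C M p -> coef_cvg p c ->
  coef_cvg (fun n => taylor x (p n)) (fun i => power_sum (nderiv_seq i c) x).
Proof.
move=> M0 dp cp i /=.
have -> : (fun n => (taylor x (p n))`_i) = fun n => ((p n)^`N(i)).[x].
  by apply/funext => n; rewrite coef_taylor.
exact: (@horner_cvg _ _ _ _ x M0 (nderivn_dominated i M0 dp)
  (@nderivn_coef_cvg _ _ i cp)).
Qed.

End DominatedSequences.

(** * Convergence of the zeros *)

Section ZerosOfLimits.
Variable R : realType.
Implicit Types (C M x B : R) (c u : nat -> R) (p : nat -> {poly R}).

Lemma horner_lipschitz C M p B n x y : 0 <= M -> dominated C M p ->
  `|x| <= B -> `|y| <= B ->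
  `|(p n).[y] - (p n).[x]| <= C * M * expR (M * B) * `|y - x|.
Proof.
move=> M0 dp; wlog xy : x y / x < y.
  move=> W xB yB; case: (ltgtP x y) => [xy|yx|->].
  - exact: W.
  - by rewrite distrC [`|y - x|]distrC; exact: W.
  - by rewrite !subrr !normr0 mulr0.
move=> xB yB; have [z zxy ->] := poly_mvt (p n) xy.
rewrite normrM ler_wpM2r // -nderivn1.
have := horner_bound z n M0 (nderivn_dominated 1 M0 dp).
rewrite expr1 divr1 => /le_trans; apply.
have CM : 0 <= C * M by rewrite mulr_ge0 // (exp_bounded_ge0 (dp n)).
rewrite ler_wpM2l // ler_expR ler_wpM2l //.
move: zxy xB yB; rewrite in_itv /= !ler_norml => /andP[xz zy] /andP[? ?]
  /andP[? ?].
by apply/andP; split; lra.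
Qed.

Lemma power_sum_lipschitz C M p c B x y : 0 <= M -> dominated C M p ->
  coef_cvg p c -> `|x| <= B -> `|y| <= B ->
  `|power_sum c y - power_sum c x| <= C * M * expR (M * B) * `|y - x|.
Proof.
move=> M0 dp cp xB yB.
have h : `|(p n).[y] - (p n).[x]| @[n --> \oo] -->
    `|power_sum c y - power_sum c x|.
  by apply: cvg_norm; apply: cvgB; exact: (horner_cvg M0 dp cp).
by apply: (cvgr_to_le h); near=> n; exact: horner_lipschitz.
Unshelve. all: by end_near. Qed.

Lemma power_sum_continuous C M p c : 0 <= M -> dominated C M p ->
  coef_cvg p c -> continuous (power_sum c).
Proof.
move=> M0 dp cp x; apply/cvgrPdist_le => /= e e0.
pose L := C * M * expR (M * (`|x| + 1)) + 1.
have L0 : 0 < L.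
  rewrite ltr_wpDl // mulr_ge0 ?expR_ge0 // mulr_ge0 //.
  exact: exp_bounded_ge0 (dp 0%N).
near=> y.
have xy : `|x - y| <= Num.min 1 (e / L).
  near: y; apply: cvgr_dist_le; first exact: cvg_id.
  by rewrite lt_min ltr01 divr_gt0.
have yB : `|y| <= `|x| + 1.
  rewrite (_ : y = x - (x - y)); last by ring.
  apply: le_trans (ler_normB _ _) _; rewrite lerD2l.
  by apply: le_trans xy _; rewrite ge_min lexx.
apply: le_trans (power_sum_lipschitz M0 dp cp yB _) _; first by rewrite lerDl.
apply: (@le_trans _ _ (L * `|x - y|)).
  by rewrite ler_wpM2r // /L lerDl.
rewrite mulrC -ler_pdivlMr //; apply: le_trans xy _.
by rewrite ge_min lexx orbT.
Unshelve. all: by end_near. Qed.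

(** By compactness [|F|] has a positive minimum on [[l, w]]; from some [n] on, [p n] is within half
    of it. *)
Lemma eventually_no_root C M p c (l w : R) : 0 <= M -> dominated C M p ->
  coef_cvg p c -> (forall x, l <= x <= w -> power_sum c x != 0) ->
  \forall n \near \oo, forall x, l <= x <= w -> ~~ root (p n) x.
Proof.
move=> M0 dp cp nz; have [lw|wl] := leP l w; last first.
  by near=> n => x /andP[lx xw]; have := le_trans lx xw; rewrite leNgt wl.
have [z zlw zmin] : exists2 z, z \in `[l, w] &
    forall t, t \in `[l, w] -> `|power_sum c z| <= `|power_sum c t|.
  apply: (@EVT_min R (fun t => `|power_sum c t|)) => //.
  apply: continuous_subspaceT => t; apply: cvg_norm.
  exact: (power_sum_continuous M0 dp cp).
have dz : 0 < `|power_sum c z| by rewrite normr_gt0 nz.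
have d2 : 0 < `|power_sum c z| / 2 by rewrite divr_gt0.
apply: filterS (@horner_unif_cvg R C M p c (Num.max `|l| `|w|) _ M0 dp cp d2).
move=> n H x lxw; apply/negP => /rootP rx.
have /H : `|x| <= Num.max `|l| `|w|.
  move: lxw => /andP[lx xw]; rewrite ler_norml le_max; apply/andP; split.
    rewrite lerNl le_max; apply/orP; left.
    by apply: (@le_trans _ _ (- l)); [rewrite lerN2|rewrite -normrN ler_norm].
  by rewrite (le_trans xw (ler_norm w)) orbT.
rewrite rx sub0r normrN leNgt; apply/negP; rewrite negbK.
apply: lt_le_trans (zmin x _); last by rewrite in_itv.
by rewrite ltr_pdivrMr // ltr_pMr // ltr1n.
Unshelve. all: by end_near. Qed.

(** Near [w] the derivatives of the [p n] stay close to [d = F'(w)], so [d * p n] increases with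
    slope at least [d^2/2]. It thus has at most one zero there, and it changes sign on [[w-e, w+e]]
    as soon as its value at [w] is small against [e]. *)
Lemma simple_zero_isolated C M p c (w : R) : 0 <= M -> dominated C M p ->
  coef_cvg p c -> power_sum c w = 0 -> power_sum (nderiv_seq 1 c) w != 0 ->
  exists e0, 0 < e0 /\
    (\forall n \near \oo, forall x y, w - e0 <= x <= w + e0 ->
       w - e0 <= y <= w + e0 -> root (p n) x -> root (p n) y -> x = y) /\
    (forall e, 0 < e -> e <= e0 -> \forall n \near \oo,
       exists z, w - e < z < w + e /\ root (p n) z).
Proof.
move=> M0 dp cp Fw dw; set d := power_sum _ w in dw.
have dp1 := nderivn_dominated 1 M0 dp.
have cp1 := @nderivn_coef_cvg R p c 1 cp.
(* A quarter of [|d|] pays for the variation of [F'] near [w] and another for the convergence of the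
   derivatives, which leaves half of [d^2] as slope. *)
have d40 : 0 < `|d| / 4 by rewrite divr_gt0 // normr_gt0.
have [e0 /= e00 e0P] : exists2 e0, 0 < e0 & forall x, `|w - x| <= e0 ->
    `|d - power_sum (nderiv_seq 1 c) x| <= `|d| / 4.
  have := power_sum_continuous M0 dp1 cp1 (x := w).
  move=> /cvgrPdist_le/(_ _ d40)/nbhs_ballP[e /= e0 eP].
  exists (e / 2); first by rewrite divr_gt0.
  move=> x xe; apply: eP; rewrite /ball /=; apply: le_lt_trans xe _.
  by rewrite ltr_pdivrMr // ltr_pMr // ltr1n.
have der : \forall n \near \oo, forall x, w - e0 <= x <= w + e0 ->
    d ^+ 2 / 2 <= d * (p n)^`().[x].
  apply: filterS (@horner_unif_cvg R _ M _ _ (`|w| + e0) _ M0 dp1 cp1 d40).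
  move=> n H x xw.
  have xw' : `|w - x| <= e0.
    by move: xw => /andP[? ?]; rewrite ler_norml; apply/andP; split; lra.
  have /H : `|x| <= `|w| + e0.
    rewrite (_ : x = w - (w - x)); last by ring.
    by apply: le_trans (ler_normB _ _) _; rewrite lerD2l.
  have := e0P x xw'; rewrite nderivn1.
  set D := _.[x]; set S := power_sum _ x => h1 h2.
  have : `|d * (d - D)| <= d ^+ 2 / 2.
    rewrite normrM (_ : d ^+ 2 = `|d| * `|d|);
      last by rewrite -expr2 real_normK ?num_real.
    rewrite -mulrA ler_wpM2l // (_ : d - D = (d - S) - (D - S)); last by ring.
    by apply: le_trans (ler_normB _ _) _; lra.
  rewrite ler_norml => /andP[_]; rewrite mulrBr -expr2; lra.
have incr n x y : (forall x, w - e0 <= x <= w + e0 ->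
      d ^+ 2 / 2 <= d * (p n)^`().[x]) ->
    w - e0 <= x -> x < y -> y <= w + e0 ->
    d ^+ 2 / 2 * (y - x) <= d * (p n).[y] - d * (p n).[x].
  move=> H wx xy yw; have [z] := poly_mvt (p n) xy.
  rewrite in_itv /= => /andP[xz zy] E; rewrite -mulrBr E mulrA ler_wpM2r //.
    by rewrite subr_ge0 ltW.
  by apply: H; apply/andP; split; lra.
have d20 : 0 < d ^+ 2 / 2 by rewrite divr_gt0 // exprn_even_gt0.
exists e0; split=> //; split.
  apply: filterS der => n H x y; wlog xy : x y / x < y.
    move=> W hx hy rx ry; case: (ltgtP x y) => // xy; first exact: (W x y).
    by apply/esym; apply: (W y x).
  move=> /andP[wx _] /andP[_ yw] /rootP rx /rootP ry.
  have := incr n x y H wx xy yw; rewrite rx ry !mulr0 subrr => h.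
  by have := lt_le_trans (mulr_gt0 d20 (_ : 0 < y - x)) h;
    rewrite subr_gt0 ltxx => /(_ xy).
move=> e e_gt0 ee0.
have q0 : 0 < d ^+ 2 / 2 * e / 2 by rewrite divr_gt0 // mulr_gt0.
have small : \forall n \near \oo, `|d * (p n).[w]| <= d ^+ 2 / 2 * e / 2.
  have h : `|d * (p n).[w]| @[n --> \oo] --> `|d * power_sum c w|.
    apply: cvg_norm; apply: cvgM; first exact: cvg_cst.
    exact: (horner_cvg M0 dp cp).
  rewrite Fw mulr0 normr0 in h.
  move/cvgrPdist_le: h => /(_ _ q0); apply: filterS => n.
  by rewrite sub0r normrN normr_id.
apply: filterS2 der small => n H; rewrite ler_norml => /andP[s1 s2].
have i1 := incr n (w - e) w H; have i2 := incr n w (w + e) H.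
have h1 : d * (p n).[w - e] < 0.
  have : d ^+ 2 / 2 * (w - (w - e)) <= d * (p n).[w] - d * (p n).[w - e].
    by apply: i1; lra.
  by rewrite (_ : w - (w - e) = e); [lra|ring].
have h2 : 0 < d * (p n).[w + e].
  have : d ^+ 2 / 2 * (w + e - w) <= d * (p n).[w + e] - d * (p n).[w].
    by apply: i2; lra.
  by rewrite (_ : w + e - w = e); [lra|ring].
have [||z zw rz] := @root_between R (p n) (w - e) (w + e).
- by lra.
- have : (d * (p n).[w - e]) * (d * (p n).[w + e]) < 0 by rewrite nmulr_rlt0.
  rewrite mulrACA -expr2 pmulr_rlt0 // exprn_even_gt0 //.
- by exists z.
Qed.

Lemma nth_le (xs : seq R) i j : sorted <%R xs -> (i <= j < size xs)%N ->
  xs`_i <= xs`_j.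
Proof.
move=> sxs /andP[]; rewrite leq_eqVlt => /orP[/eqP -> //|ij] js.
by rewrite ltW // nth_lt // ij.
Qed.

Lemma roots_cvg C M p c (ys : nat -> seq R) (f : nat -> R) :
    0 <= M -> dominated C M p -> coef_cvg p c ->
    (forall n, [/\ sorted <%R (ys n), all (> 0) (ys n)
       & forall x, root (p n) x = (x \in ys n)]) ->
    {homo f : k l / (k < l)%N >-> k < l} -> 0 < f 0%N ->
    (forall x, power_sum c x = 0 <-> exists k, x = f k) ->
    (forall k, power_sum (nderiv_seq 1 c) (f k) != 0) ->
  forall k, (ys n)`_k @[n --> \oo] --> f k.
Proof.
move=> M0 dp cp ysP fmono f0 fP fsimple.
have fle k l : (k <= l)%N -> f k <= f l.
  by rewrite leq_eqVlt => /orP[/eqP -> //|/fmono/ltW].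
(* The invariant of the induction on [k]: some level [l] below [f k], with no zero of the limit in
   [[l, f k)], has eventually exactly the first [k] zeros of [p n] below it. The next level is
   [f k + e1]. *)
pose J k := exists l, [/\ l < f k,
  forall x, l <= x < f k -> power_sum c x != 0 &
  \forall n \near \oo, forall i, (i < size (ys n))%N ->
    ((ys n)`_i < l) = (i < k)%N].
have step k : J k ->
    ((ys n)`_k @[n --> \oo] --> f k) /\ J k.+1.
  move=> [l [lf lnz lP]].
  have Fk : power_sum c (f k) = 0 by apply/fP; exists k.
  have [e0 [e00 [uniq_r ex_r]]] := simple_zero_isolated M0 dp cp Fk (fsimple k).
  have fk1 : f k < f k.+1 by apply: fmono.
  (* Within [e1] of [f k] the zero of [p n] is unique, and the interval stays away from both [l] and
     the next zero [f k.+1]. *)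
  pose e1 := Num.min e0 (Num.min ((f k - l) / 2) ((f k.+1 - f k) / 2)).
  have e10 : 0 < e1 by rewrite !lt_min e00 !divr_gt0 // subr_gt0.
  have e1e0 : e1 <= e0 by rewrite ge_min lexx.
  have e1l : e1 <= (f k - l) / 2 by rewrite !ge_min lexx !orbT.
  have e1r : e1 <= (f k.+1 - f k) / 2 by rewrite !ge_min lexx !orbT.
  have main e : 0 < e -> e <= e1 -> \forall n \near \oo,
      [/\ `|f k - (ys n)`_k| <= e, (k < size (ys n))%N &
      forall i, (i < size (ys n))%N -> ((ys n)`_i < f k + e1) = (i < k.+1)%N].
    move=> ep ee1.
    have nor : \forall n \near \oo, forall x, l <= x <= f k - e -> ~~ root (p
      n) x.
      apply: (eventually_no_root M0 dp cp) => x /andP[lx xf].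
      by apply: lnz; rewrite lx (le_lt_trans xf) // ltrBlDr ltrDl.
    have exr := ex_r e ep (le_trans ee1 e1e0).
    near=> n.
    have Hl : forall i, (i < size (ys n))%N -> ((ys n)`_i < l) = (i < k)%N.
      by near: n.
    have Hn : forall x, l <= x <= f k - e -> ~~ root (p n) x by near: n.
    have Hu : forall x y, f k - e0 <= x <= f k + e0 ->
       f k - e0 <= y <= f k + e0 -> root (p n) x -> root (p n) y -> x = y.
      by near: n.
    have [z [/andP[z1 z2] rz]] : exists z, f k - e < z < f k + e /\ root (p n) z.
      by near: n.
    have [sy _ rP] := ysP n.
    have := rz; rewrite rP => /(nthP 0)[j js Ej].
    have kj : (k <= j)%N by rewrite leqNgt -(Hl j js) Ej -leNgt; lra.
    have ks : (k < size (ys n))%N := leq_ltn_trans kj js.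
    have rk : root (p n) (ys n)`_k by rewrite rP mem_nth.
    have lk : l <= (ys n)`_k by rewrite leNgt (Hl k ks) ltnn.
    have fk : f k - e < (ys n)`_k.
      rewrite ltNge; apply/negP => h; have := Hn (ys n)`_k; rewrite lk h rk.
      by move=> /(_ isT).
    have kz : (ys n)`_k <= z by rewrite -Ej nth_le // kj.
    have Ek : (ys n)`_k = z.
      by apply: Hu => //; apply/andP; split; lra.
    split=> //; first by rewrite Ek ler_norml; apply/andP; split; lra.
    move=> i is_; apply/idP/idP => [ilt|]; last first.
      rewrite ltnS => ik; apply: (@le_lt_trans _ _ (ys n)`_k); last by lra.
      by rewrite nth_le // ik.
    rewrite ltnS leqNgt; apply/negP => ki.
    have lt_k : (ys n)`_k < (ys n)`_i by rewrite nth_lt // ki.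
    suff : (ys n)`_k = (ys n)`_i by move=> E; rewrite E ltxx in lt_k.
    apply: Hu => //; last by rewrite rP mem_nth.
      by apply/andP; split; lra.
    by apply/andP; split; lra.
  split.
    apply/cvgrPdist_le => e ep.
    have me : 0 < Num.min e e1 by rewrite lt_min ep.
    have me1 : Num.min e e1 <= e1 by rewrite ge_min lexx orbT.
    apply: filterS (main _ me me1) => n [h _ _]; apply: le_trans h _.
    by rewrite ge_min lexx.
  exists (f k + e1); split; first by lra.
    move=> x /andP[x1 x2]; apply/eqP => /fP[j Ej].
    have : (k < j < k.+1)%N.
      apply/andP; split; rewrite ltnNge; apply/negP => /fle; rewrite -Ej; lra.
    by lia.
  by apply: filterS (main _ e10 (lexx _)) => n [].
have J0 : J 0%N.
  (* Level 0 starts the induction, since no [p n] has a zero below it. *)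
  exists 0; split=> //.
    move=> x /andP[_ xf]; apply/eqP => /fP[j Ej].
    by have := fle 0%N j (leq0n j); rewrite -Ej leNgt xf.
  near=> n => i is_; have [_ /(all_nthP 0)/(_ i is_) h _] := ysP n.
  by rewrite ltn0 lt_gtF.
move=> k; suff : J k by move=> /step[].
by elim: k => // k /step[].
Unshelve. all: by end_near. Qed.

End ZerosOfLimits.

(** * Simplicity of the zeros of the limit *)

Lemma bin_mul_bin i k l :
  ('C(i + (k + l), i) * 'C(k + l, k) = 'C((i + k) + l, i + k) * 'C(i + k, i))%N.
Proof.
apply/eqP; rewrite -(eqn_pmul2r (fact_gt0 i)) -(eqn_pmul2r (fact_gt0 k)).
rewrite -(eqn_pmul2r (fact_gt0 l)); apply/eqP.
have e1 := bin_fact (leq_addr (k + l) i); rewrite addKn in e1.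
have e2 := bin_fact (leq_addr l k); rewrite addKn in e2.
have e3 := bin_fact (leq_addr l (i + k)); rewrite addKn in e3.
have e4 := bin_fact (leq_addr k i); rewrite addKn in e4.
transitivity (i + (k + l))`!; first by rewrite -e1 -e2; ring.
by rewrite addnA -e3 -e4; ring.
Qed.

Section Simplicity.
Variable R : realType.
Implicit Types (C M x B w : R) (c u : nat -> R) (p g : nat -> {poly R}).

(** Every series with exponentially bounded coefficients is the limit of its truncations, so that
    results on limits of polynomials apply to it, in particular continuity. *)
Lemma truncation_dominated C M u : 0 <= M -> exp_bounded C M u ->
  dominated C M (fun n => \poly_(k < n) u k).
Proof.
move=> M0 bu n k; rewrite coef_poly; case: ifP => // _; rewrite normr0.
by rewrite mulr_ge0 ?(exp_bounded_ge0 bu) // divr_ge0 // exprn_ge0.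
Qed.

Lemma truncation_coef_cvg u : coef_cvg (fun n => \poly_(k < n) u k) u.
Proof.
move=> k; apply: cvg_near_cst; near=> n; rewrite coef_poly ifT //.
by near: n; exact: nbhs_infty_gt.
Unshelve. all: by end_near. Qed.

Lemma power_sum_at0 u : power_sum u 0 = u 0%N.
Proof.
apply: (cvg_lim (@Rhausdorff R)); rewrite -cvg_shiftS.
apply: cvg_near_cst; near=> n.
rewrite /series /= big_nat_recl // expr0 mulr1 big1 ?addr0 // => k _.
by rewrite exprS mul0r mulr0.
Unshelve. all: by end_near. Qed.

Lemma exp_bounded_shift C M u m : 0 <= M -> exp_bounded C M u ->
  exp_bounded (C * M ^+ m) M (fun k => u (m + k)%N).
Proof.
move=> M0 bu k; apply: le_trans (bu _) _.
rewrite -mulrA ler_wpM2l ?(exp_bounded_ge0 bu) // exprD -mulrA.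
rewrite ler_wpM2l ?exprn_ge0 // ler_wpM2l ?exprn_ge0 //.
rewrite lef_pV2 ?posrE ?ltr0n ?fact_gt0 // ler_nat.
by rewrite leq_fact ?leq_addl.
Qed.

Lemma power_sum_shift C M u m x : 0 <= M -> exp_bounded C M u ->
  (forall k, (k < m)%N -> u k = 0) ->
  power_sum u x = x ^+ m * power_sum (fun k => u (m + k)%N) x.
Proof.
move=> M0 bu u0.
have hs : (fun n => x ^+ m * series (fun k => u (m + k)%N * x ^+ k) n) =
    fun n => series (fun k => u k * x ^+ k) (n + m)%N.
  apply/funext => n; rewrite /series /= (addnC n).
  rewrite [RHS](big_cat_nat (n := m)) ?leq_addr //=.
  rewrite [X in _ = X + _]big_nat_cond [X in _ = X + _]big1 ?add0r; last first.
    by move=> k /andP[/andP[_ km] _]; rewrite u0 // mul0r.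
  have -> : \sum_(m <= k < m + n) u k * x ^+ k =
      \sum_(0 <= k < n) u (k + m)%N * x ^+ (k + m).
    by rewrite -{1}[m]add0n big_addn addKn.
  rewrite mulr_sumr.
  by apply: eq_bigr => k _; rewrite addnC exprD; ring.
have bv := exp_bounded_shift m M0 bu.
have h1 : x ^+ m * series (fun k => u (m + k)%N * x ^+ k) n @[n --> \oo] -->
    x ^+ m * power_sum (fun k => u (m + k)%N) x.
  by apply: cvgM; [exact: cvg_cst|exact: power_sum_cvg bv].
have h2 := power_sum_cvg (x := x) M0 bu; rewrite hs in h1.
rewrite (cvg_shiftn m (series (fun k => u k * x ^+ k))) in h1.
exact: (cvg_unique (@Rhausdorff R) h2 h1).
Qed.

Lemma power_sum_equiv C M u m (t : nat -> R) : 0 <= M -> exp_bounded C M u ->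
  (forall k, (k < m)%N -> u k = 0) ->
  (forall n, t n != 0) -> t @ \oo --> (0 : R) ->
  power_sum u (t n) / t n ^+ m @[n --> \oo] --> u m.
Proof.
move=> M0 bu u0 t0 tl.
have bv := exp_bounded_shift m M0 bu.
have E : (fun n => power_sum u (t n) / t n ^+ m) =
    fun n => power_sum (fun k => u (m + k)%N) (t n).
  apply/funext => n; rewrite (power_sum_shift _ M0 bu u0).
  by rewrite mulrC mulKf // expf_neq0.
rewrite E -[X in u X]addn0 -(power_sum_at0 (fun k => u (m + k)%N)).
apply: cvg_comp tl _.
exact: (power_sum_continuous M0 (truncation_dominated M0 bv)
  (@truncation_coef_cvg (fun k => u (m + k)%N)) (x := 0)).
Qed.

Lemma power_sum_mulrn C M u x m : 0 <= M -> exp_bounded C M u ->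
  power_sum (fun k => u k *+ m) x = power_sum u x *+ m.
Proof.
move=> M0 bu; apply: (cvg_lim (@Rhausdorff R)).
have -> : series (fun k => u k *+ m * x ^+ k) =
    fun n => series (fun k => u k * x ^+ k) n * m%:R.
  apply/funext => n; rewrite /series /= mulr_suml.
  by apply: eq_bigr => k _; rewrite -[u k *+ m]mulr_natr mulrAC.
rewrite -[X in _ --> X]mulr_natr.
by apply: cvgM; [exact: power_sum_cvg bu|exact: cvg_cst].
Qed.

Lemma taylor_nderiv C M p c i k w : 0 <= M -> dominated C M p ->
  coef_cvg p c -> power_sum (nderiv_seq k (nderiv_seq i c)) w =
  power_sum (nderiv_seq (i + k) c) w *+ 'C(i + k, i).
Proof.
move=> M0 dp cp.
have b := exp_bounded_lim (nderivn_dominated (i + k) M0 dp)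
  (@nderivn_coef_cvg R p c (i + k) cp).
rewrite -(power_sum_mulrn _ _ M0 b); congr power_sum.
apply/funext => l; rewrite /nderiv_seq -!mulrnA addnA.
by congr (_ *+ _); rewrite -bin_mul_bin addnA.
Qed.

(** The expansion holds for each [p n]; the translated polynomials are again dominated and converge
    coefficientwise, so both sides pass to the limit. *)
Lemma power_sum_taylor C M p c i w t : 0 <= M -> dominated C M p ->
  coef_cvg p c -> power_sum (nderiv_seq i c) (w + t) =
  power_sum (fun k => power_sum (nderiv_seq (i + k) c) w *+ 'C(i + k, i)) t.
Proof.
move=> M0 dp cp.
have di := nderivn_dominated i M0 dp.
have ci := @nderivn_coef_cvg R p c i cp.
have h1 := horner_cvg (x := w + t) M0 di ci.
have h2 := horner_cvg (x := t) M0 (taylor_dominated w M0 di) (taylor_coef_cvg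
  (x := w) M0 di ci).
have E : (fun n => (taylor w (p n)^`N(i)).[t]) = fun n => ((p n)^`N(i)).[w + t].
  by apply/funext => n; rewrite horner_taylor.
rewrite E in h2.
rewrite (cvg_unique (@Rhausdorff R) h1 h2); congr power_sum.
by apply/funext => k; rewrite (taylor_nderiv _ _ _ M0 dp cp).
Qed.

(** Were all derivatives zero at [w], the expansion at [w] evaluated at 0 would give [c 0 = 0].
    Hence every zero has finite order. *)
Lemma taylor_neq0 C M p c w : 0 <= M -> dominated C M p -> coef_cvg p c ->
  c 0%N != 0 -> exists k, power_sum (nderiv_seq k c) w != 0.
Proof.
move=> M0 dp cp; apply: contraNP => /forallNP H.
have h1 := power_sum_taylor 0 w (- w) M0 dp cp.
rewrite subrr nderiv_seq0 power_sum_at0 in h1.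
rewrite h1; apply/eqP.
have -> : (fun k => power_sum (nderiv_seq (0 + k) c) w *+ 'C(0 + k, 0)) = fun=> 0.
  by apply/funext => k; have /negP/negPn/eqP := H k; rewrite add0n => ->;
    rewrite mul0rn.
apply: (cvg_lim (@Rhausdorff R)); apply: cvg_near_cst; near=> n.
by rewrite /series /= big1 // => k _; rewrite mul0r.
Unshelve. all: by end_near. Qed.

(** With [al = a_r] and [kappa = a_1 ... a_(r-1)], this operator sends [0Fr(a; -z)] to the same
    function with [a_1, ..., a_(r-1)] raised by 1. *)
Definition second_order (kappa al : R) (q : {poly R}) : {poly R} :=
  - kappa *: (al *: q^`() + 'X * q^`(2)).

Lemma coef_second_order kappa al q k : (second_order kappa al q)`_k =
  - kappa * (k%:R + 1) * (al + k%:R) * q`_k.+1.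
Proof.
rewrite coefZ coefD coefZ coef_deriv coefXM -[_ *+ k.+1]mulr_natr -natr1.
case: k => [|k] /=; first by ring.
by rewrite !coef_deriv -mulrnA -[_ *+ (_ * _)]mulr_natr natrM -!natr1; ring.
Qed.

(** The factor [k+1] disappears into the factorial, while [al + k] grows with [k] and is absorbed by
    doubling [M]. *)
Lemma second_order_dominated C M p kappa al : 0 <= M -> dominated C M p ->
  dominated (`|kappa| * (`|al| + 1) * C * M) (2 * M)
    (fun n => second_order kappa al (p n)).
Proof.
move=> M0 dp n k; rewrite coef_second_order.
have C0 := exp_bounded_ge0 (dp n).
have k10 : 0 < (k%:R + 1 : R) by rewrite natr1 ltr0n.
rewrite 3!normrM normrN (ger0_norm (ltW k10)).
have h1 : `|al + k%:R| <= (`|al| + 1) * 2 ^+ k.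
  apply: le_trans (ler_normD _ _) _; rewrite (ger0_norm (ler0n _ _)) mulrDl mul1r.
  rewrite lerD //; first by rewrite ler_peMr // exprn_ege1 // ler1n.
  by rewrite -natrX ler_nat ltnW // ltn_expl.
have h2 := dp n k.+1.
have -> : `|kappa| * (`|al| + 1) * C * M * ((2 * M) ^+ k / k`!%:R) =
    `|kappa| * (k%:R + 1) * ((`|al| + 1) * 2 ^+ k) *
    (C * (M ^+ k.+1 / (k.+1)`!%:R)).
  rewrite exprMn exprS factS natrM -natr1.
  have f0 : (k`!%:R : R) != 0 by rewrite pnatr_eq0 -lt0n fact_gt0.
  by field; rewrite f0 gt_eqF.
have h3 : 0 <= `|kappa| * (k%:R + 1) by rewrite mulr_ge0 // ltW.
apply: ler_pM; [by rewrite mulr_ge0|exact: normr_ge0| |exact: h2].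
exact: (ler_wpM2l h3 h1).
Qed.

(* If [f] had a zero of order [m >= 2] at [w > 0], then [al f' + x f''] would
   have one of order [m - 2], and the Wronskian of the two would change sign. *)
Lemma limit_zero_simple C M C' M' p g c e al kappa w :
    0 <= M -> dominated C M p -> coef_cvg p c ->
    0 <= M' -> dominated C' M' g -> coef_cvg g e ->
    c 0%N != 0 -> 0 < kappa ->
    (forall k, e k = - kappa * (k%:R + 1) * (al + k%:R) * c k.+1) ->
    (forall n x, 0 <= (wronskian (p n) (g n)).[x]) -> 0 < w ->
    power_sum c w = 0 ->
  power_sum (nderiv_seq 1 c) w != 0.
Proof.
move=> M0 dp cp M'0 dg cg c0 kappa0 eE W0 w0 Fw; apply/eqP => dFw.
pose F i x := power_sum (nderiv_seq i c) x.
have Fcvg i x : ((p n)^`N(i)).[x] @[n --> \oo] --> F i x.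
  exact: horner_cvg M0 (nderivn_dominated i M0 dp) (@nderivn_coef_cvg _ _ _ i cp).
pose q n := second_order kappa al (p n).
have dq : dominated _ _ q := second_order_dominated kappa al M0 dp.
have M20 : 0 <= 2 * M by rewrite mulr_ge0.
have cq : coef_cvg q e.
  move=> k; have -> : (fun n => (q n)`_k) =
      fun n => - kappa * (k%:R + 1) * (al + k%:R) * (p n)`_k.+1.
    by apply/funext => n; rewrite coef_second_order.
  by rewrite eE; apply: cvgM; [exact: cvg_cst|exact: cp].
have GE x : power_sum e x = - kappa * (al * F 1 x + x * (2 * F 2 x)).
  apply: (cvg_unique (@Rhausdorff R) (horner_cvg (x := x) M20 dq cq)).
  have -> : (fun n => (q n).[x]) = fun n => - kappa *
      (al * (p n)^`N(1).[x] + x * (2 * (p n)^`N(2).[x])).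
    apply/funext => n; rewrite /q /second_order hornerZ hornerD hornerZ hornerM
      hornerX.
    by rewrite nderivn1 nderivn_def hornerMn (_ : 2`! = 2)%N //; ring.
  apply: cvgM; first exact: cvg_cst.
  apply: cvgD; (apply: cvgM; first exact: cvg_cst) => //.
  by apply: cvgM; first exact: cvg_cst.
have G1E x : power_sum (nderiv_seq 1 e) x =
    - kappa * ((al + 1) * (2 * F 2 x) + x * (6 * F 3 x)).
  apply: (cvg_unique (@Rhausdorff R) (horner_cvg (x := x) M20
    (nderivn_dominated 1 M20 dq) (@nderivn_coef_cvg _ _ _ 1 cq))).
  have -> : (fun n => (q n)^`N(1).[x]) = fun n => - kappa *
      ((al + 1) * (2 * (p n)^`N(2).[x]) + x * (6 * (p n)^`N(3).[x])).
    apply/funext => n; rewrite /q /second_order nderivn1 derivZ hornerZ.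
    rewrite derivD derivZ derivM derivX mul1r !hornerD hornerZ hornerM hornerX.
    rewrite -!derivnS -[(p n)^`()^`()]/((p n)^`(2)) !nderivn_def !hornerMn.
    by rewrite (_ : 2`! = 2)%N // (_ : 3`! = 6)%N //; ring.
  apply: cvgM; first exact: cvg_cst.
  apply: cvgD; (apply: cvgM; first exact: cvg_cst) => //.
    by apply: cvgM; first exact: cvg_cst.
  by apply: cvgM; first exact: cvg_cst.
have WE x : 0 <= F 0%N x * power_sum (nderiv_seq 1 e) x - F 1 x * power_sum e x.
  have h : (p n).[x] * (g n)^`N(1).[x] - (p n)^`N(1).[x] * (g n).[x]
      @[n --> \oo] -->
      F 0%N x * power_sum (nderiv_seq 1 e) x - F 1 x * power_sum e x.
    apply: cvgB; apply: cvgM.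
    - have -> : (fun n => (p n).[x]) = fun n => (p n)^`N(0).[x].
        by apply/funext => n; rewrite nderivn0.
      exact: Fcvg.
    - exact: horner_cvg M'0 (nderivn_dominated 1 M'0 dg) (@nderivn_coef_cvg _ _
      _ 1 cg).
    - exact: Fcvg.
    - exact: horner_cvg M'0 dg cg.
  apply: (cvgr_to_ge h); near=> n; have := W0 n x.
  by rewrite /wronskian hornerD hornerN !hornerM !nderivn1.
pose d k := power_sum (nderiv_seq k c) w.
have [m0 dm0] := taylor_neq0 w M0 dp cp c0.
have exm : exists m, d m != 0 by exists m0.
case: (ex_minnP exm) => m dm mmin.
have d_lt k : (k < m)%N -> d k = 0.
  by move=> km; apply/eqP; apply: contraTT km => /mmin; rewrite -leqNgt.
have [nu Em] : exists nu, m = nu.+2.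
  case: m dm {mmin d_lt} => [|[|nu]] dm; last by exists nu.
    by move: dm; rewrite /d nderiv_seq0 Fw eqxx.
  by move: dm; rewrite /d dFw eqxx.
(* The points [w + t n] approach [w] from the left, the side on which a Wronskian of odd order and
   positive leading coefficient would be negative. *)
pose t n : R := - (n.+1%:R)^-1.
have t0 n : t n != 0 by rewrite oppr_eq0 invr_eq0 pnatr_eq0.
have tneg n : t n < 0 by rewrite oppr_lt0 invr_gt0 ltr0n.
have tl : t @ \oo --> (0 : R).
  by rewrite -oppr0; apply: cvgN; exact: cvg_harmonic.
have bT i : exists C1, exp_bounded C1 M (fun k => d (i + k)%N *+ 'C(i + k, i)).
  have di := nderivn_dominated i M0 dp.
  have ci := @nderivn_coef_cvg R p c i cp.
  have b := exp_bounded_lim (taylor_dominated w M0 di) (taylor_coef_cvg (x :=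
    w) M0 di ci).
  eexists => k; have := b k; rewrite (taylor_nderiv _ _ _ M0 dp cp); exact.
have asym i j : (i + j = m)%N ->
    F i (w + t n) / t n ^+ j @[n --> \oo] --> d m *+ 'C(m, i).
  move=> ij; have [C1 b] := bT i.
  have := power_sum_equiv (m := j) M0 b _ t0 tl; rewrite ij => h.
  have -> : (fun n => F i (w + t n) / t n ^+ j) = fun n =>
      power_sum (fun k => d (i + k)%N *+ 'C(i + k, i)) (t n) / t n ^+ j.
    by apply/funext => n; rewrite /F (power_sum_taylor _ _ _ M0 dp cp).
  by apply: h => k kj; rewrite d_lt ?mul0rn // -ij ltn_add2l.
have h0 := asym 0%N nu.+2 (esym Em).
have h1 := asym 1%N nu.+1 (esym Em).
have h2 := asym 2%N nu (esym Em).
(* For [m = 2] there is no power [t^(m-3)] to divide by; the spare factor [t n] then gives the limit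
   0, which agrees with ['C(2, 3) = 0]. *)
have h3 : t n * F 3%N (w + t n) / t n ^+ nu @[n --> \oo] --> d m *+ 'C(m, 3).
  case: nu Em {h0 h1 h2} => [|nu] Em.
    rewrite Em mulr0n.
    have -> : (fun n => t n * F 3%N (w + t n) / t n ^+ 0) =
        fun n => t n * F 3%N (w + t n).
      by apply/funext => n; rewrite expr0 divr1.
    rewrite -(mul0r (F 3%N w)); apply: cvgM => //.
    have -> : F 3%N w = F 3%N (w + 0) by rewrite addr0.
    have wt : w + t n @[n --> \oo] --> w + 0 by apply: cvgD => //; exact: cvg_cst.
    apply: cvg_comp wt _.
    exact: (power_sum_continuous M0 (nderivn_dominated 3 M0 dp)
      (@nderivn_coef_cvg _ _ _ 3 cp) (x := w + 0)).
  have := asym 3%N nu (esym Em); apply: cvg_trans; apply: near_eq_cvg; near=> n.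
  by rewrite exprS; field; rewrite t0 expf_neq0.
(* [V n] is [t n] times the Wronskian at [w + t n], divided by the even power [t n ^ (2m-2)]; hence
   [V n <= 0]. Its limit is nevertheless [2 kappa w d_m^2 m (m-1) > 0]. *)
pose V n := - kappa * (t n * (2 * (al + 1)) *
    ((F 0%N (w + t n) / t n ^+ nu.+2) * (F 2%N (w + t n) / t n ^+ nu))
  + 6 * (w + t n) * ((F 0%N (w + t n) / t n ^+ nu.+2) *
      (t n * F 3%N (w + t n) / t n ^+ nu))
  - t n * al * ((F 1%N (w + t n) / t n ^+ nu.+1) * (F 1%N (w + t n) / t n ^+
    nu.+1))
  - 2 * (w + t n) * ((F 1%N (w + t n) / t n ^+ nu.+1) *
      (F 2%N (w + t n) / t n ^+ nu))).
have wt : w + t n @[n --> \oo] --> w + 0 by apply: cvgD => //; exact: cvg_cst.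
have Vl : V @ \oo --> - kappa * (0 * (2 * (al + 1)) *
    ((d m *+ 'C(m, 0)) * (d m *+ 'C(m, 2)))
  + 6 * (w + 0) * ((d m *+ 'C(m, 0)) * (d m *+ 'C(m, 3)))
  - 0 * al * ((d m *+ 'C(m, 1)) * (d m *+ 'C(m, 1)))
  - 2 * (w + 0) * ((d m *+ 'C(m, 1)) * (d m *+ 'C(m, 2)))).
  apply: cvgM; first exact: cvg_cst.
  apply: cvgB; last first.
    by apply: cvgM; [apply: cvgM => //; exact: cvg_cst|exact: cvgM].
  apply: cvgB; last first.
    by apply: cvgM; [apply: cvgM => //; exact: cvg_cst|exact: cvgM].
  apply: cvgD; last first.
    by apply: cvgM; [apply: cvgM => //; exact: cvg_cst|exact: cvgM].
  by apply: cvgM; [apply: cvgM => //; exact: cvg_cst|exact: cvgM].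
have V_le0 n : V n <= 0.
  have := WE (w + t n); rewrite G1E GE.
  set x := w + t n; set W := _ - _ => Wge.
  have tp : 0 < t n ^+ (nu.+1 * 2) by rewrite exprM exprn_even_gt0 //= expf_neq0.
  rewrite -(pmulr_rle0 _ tp).
  have -> : t n ^+ (nu.+1 * 2) * V n = t n * W.
    rewrite /V /W -/x mulnC mulSn mul1n exprD !exprS.
    by field; rewrite t0 expf_neq0.
  by rewrite nmulr_rle0.
have Vle : \forall n \near \oo, V n <= 0 by exact: nearW.
have := @cvgr_to_le _ _ eventually_filter _ _ _ _ Vl Vle.
have b1 : 'C(m, 1)%:R = nu%:R + 2 :> R by rewrite Em bin1 -2!natr1; ring.
have b2 : 2 * 'C(m, 2)%:R = (nu%:R + 2) * (nu%:R + 1) :> R.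
  have := bin_ffact m 2; rewrite Em ffactnS ffactn1 /= => /(congr1 (fun j : nat
    => j%:R : R)).
  by rewrite !natrM -2!natr1 => E; rewrite mulrC E; ring.
have b3 : 6 * 'C(m, 3)%:R = (nu%:R + 2) * (nu%:R + 1) * nu%:R :> R.
  have := bin_ffact m 3; rewrite Em 2!ffactnS ffactn1 /= => /(congr1 (fun j :
    nat => j%:R : R)).
  by rewrite !natrM -2!natr1 => E; rewrite mulrC E; ring.
rewrite bin0 mulr1n -[d m *+ 'C(m, 1)]mulr_natr -[d m *+ 'C(m, 2)]mulr_natr.
rewrite -[d m *+ 'C(m, 3)]mulr_natr b1.
rewrite [X in X <= 0](_ : _ = kappa * w * d m ^+ 2 * (nu%:R + 2) * (nu%:R + 1)
  * 2).
  have d2 : 0 < d m ^+ 2 by rewrite exprn_even_gt0.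
  have n0 : 0 <= nu%:R :> R by [].
  rewrite leNgt => /negP h; apply: h.
  by do !apply: mulr_gt0 => //; rewrite ltr_wpDl.
rewrite [LHS](_ : _ = - kappa * w * d m ^+ 2 * (6 * 'C(m, 3)%:R)
   + kappa * w * d m ^+ 2 * (nu%:R + 2) * (2 * 'C(m, 2)%:R)); last by ring.
by rewrite b2 b3; ring.
Unshelve. all: by end_near. Qed.

End Simplicity.

(** * Hypergeometric polynomials *)

Section Pochhammer.
Variable R : realFieldType.
Implicit Types z : R.

Lemma pochhammer0 z : pochhammer z 0 = 1.
Proof. by rewrite /pochhammer big_ord0. Qed.

Lemma pochhammerSr z n : pochhammer z n.+1 = pochhammer z n * (z + n%:R).
Proof. by rewrite /pochhammer big_ord_recr. Qed.

Lemma pochhammerSl z n : pochhammer z n.+1 = z * pochhammer (z + 1) n.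
Proof.
rewrite /pochhammer big_ord_recl /= addr0; congr (_ * _).
by apply: eq_bigr => i _; rewrite /bump leq0n natrD mulr1n addrA.
Qed.

Lemma pochhammer_ge z n : 0 < z -> z ^+ n <= pochhammer z n.
Proof.
move=> z0; elim: n => [|n IHn]; first by rewrite expr0 pochhammer0.
have z0' := ltW z0.
by rewrite exprSr pochhammerSr; apply: ler_pM; rewrite ?exprn_ge0 ?lerDl.
Qed.

Lemma pochhammer_gt0 z n : 0 < z -> 0 < pochhammer z n.
Proof. by move=> z0; apply: lt_le_trans (pochhammer_ge n z0);
  rewrite exprn_gt0. Qed.

Lemma falling_pochhammer z n k : (k <= n)%N ->
  falling z n = falling z (n - k) * pochhammer (z - n%:R + 1) k.
Proof.
elim: k => [|k IHk] kn; first by rewrite subn0 pochhammer0 mulr1.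
rewrite IHk ?(ltnW kn) // pochhammerSr.
have -> : (n - k = (n - k.+1).+1)%N by lia.
by rewrite fallingSr natrB // -natr1; ring.
Qed.

Lemma pochhammer_oppn n k :
  pochhammer (- n%:R : R) k = (-1) ^+ k * falling n%:R k.
Proof.
elim: k => [|k IHk]; first by rewrite pochhammer0 falling0 mulr1.
by rewrite pochhammerSr fallingSr exprS IHk; ring.
Qed.

Lemma falling_nat n : falling n%:R n = n`!%:R :> R.
Proof.
elim: n => [|n IHn]; first by rewrite falling0 fact0.
by rewrite fallingSl -{2}natr1 addrK IHn factS natrM.
Qed.

Lemma falling_gt0 z n : n%:R - 1 < z -> 0 < falling z n.
Proof.
move=> nz; apply: prodr_gt0 => u _; rewrite subr_gt0.
by apply: le_lt_trans nz; rewrite lerBrDr natr1 ler_nat.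
Qed.

(** The last factor of [falling z n]: read from that end, the product is a Pochhammer symbol. *)
Definition rev_par (n : nat) z := z - n%:R + 1.

(** Reversing the order of the coefficients exchanges falling factorials for rising ones. The
    parameter [A ord_max = n] yields both the upper parameter [-n] and the factor [1/k!]. *)
Lemma rev_coef_hyper n r s (A : 'I_r.+1 -> R) (B : 'I_s -> R) k : (k <= n)%N ->
    A ord_max = n%:R -> (forall i, 0 < rev_par n (A i)) ->
    (forall j, falling (B j) n != 0) ->
  rev_coef A B (n - k) = rev_coef A B n *
    hyper_coef (- n%:R :: [tuple rev_par n (B j) | j < s])
      [tuple rev_par n (A (widen_ord (leqnSn r) i)) | i < r] k.
Proof.
move=> kn An A0 B0; rewrite /rev_coef /hyper_coef.
have big_mktuple m (f : 'I_m -> R) :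
    \prod_(t <- [tuple f i | i < m]) pochhammer t k = \prod_i pochhammer (f i) k.
  by rewrite big_tuple; apply: eq_bigr => i _; rewrite tnth_mktuple.
rewrite big_cons !big_mktuple.
rewrite !big_ord_recr /= An falling_nat.
have -> : \prod_(i < r) falling (A (widen_ord (leqnSn r) i)) n =
    \prod_(i < r) falling (A (widen_ord (leqnSn r) i)) (n - k)
    * \prod_(i < r) pochhammer (rev_par n (A (widen_ord (leqnSn r) i))) k.
  by rewrite -big_split; apply: eq_bigr => i _ /=;
    rewrite /rev_par -falling_pochhammer.
have nzB : \prod_j falling (B j) n != 0 by apply/prodf_neq0 => j _.
move: nzB.
have -> : \prod_j falling (B j) n = \prod_j falling (B j) (n - k)
    * \prod_j pochhammer (rev_par n (B j)) k.
  by rewrite -big_split; apply: eq_bigr => j _ /=;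
    rewrite /rev_par -falling_pochhammer.
rewrite mulf_eq0 negb_or => /andP[nz1 nz2].
have nz3 : \prod_(i < r) pochhammer (rev_par n (A (widen_ord (leqnSn r) i))) k
  != 0.
  by apply/prodf_neq0 => i _; rewrite gt_eqF // pochhammer_gt0.
have f0 j : (j`!%:R : R) != 0 by rewrite pnatr_eq0 -lt0n fact_gt0.
have e1 : falling n%:R (n - k) * k`!%:R = n`!%:R :> R.
  rewrite -(falling_nat n) (falling_pochhammer _ kn) subrr add0r; congr (_ * _).
  elim: (k) => [|l IHl]; first by rewrite fact0 pochhammer0.
  by rewrite factS natrM IHl pochhammerSr -natr1; ring.
have e2 : falling n%:R k * (n - k)`!%:R = n`!%:R :> R.
  rewrite -(falling_nat n) (@falling_pochhammer _ n (n - k)%N) ?leq_subr //.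
  rewrite subKn // subrr add0r; congr (_ * _).
  elim: (n - k)%N => [|i IHi]; first by rewrite fact0 pochhammer0.
  by rewrite factS natrM IHi pochhammerSr -natr1; ring.
have -> : falling n%:R (n - k) = n`!%:R / k`!%:R :> R by rewrite -e1 mulfK.
rewrite pochhammer_oppn.
have -> : falling n%:R k = n`!%:R / (n - k)`!%:R :> R by rewrite -e2 mulfK.
have -> : (-1) ^+ n = (-1) ^+ (n - k) * (-1) ^+ k :> R by rewrite -exprD subnK.
have sk : (-1) ^+ k * (-1) ^+ k = 1 :> R by rewrite -expr2 sqrr_sign.
set S := (-1) ^+ k in sk *; set T := (-1) ^+ (n - k).
(* The square of the sign is inserted by hand, because [field] does not know that [S * S = 1]. *)
transitivity ((S * S) * (T / (n - k)`!%:R *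
  (\prod_(i < r) falling (A (widen_ord (leqnSn r) i)) (n - k) * (n`!%:R /
    k`!%:R)) /
   \prod_j falling (B j) (n - k))); first by rewrite sk mul1r.
by field; rewrite !f0 nz1 nz2 nz3.
Qed.

End Pochhammer.

(** * The intermediate polynomials as hypergeometric polynomials *)

Section Identification.
Variables (R : realType) (r s : nat).
Variables (lam : s.-tuple nat) (a : r.-tuple R) (b : s.-tuple R).

Definition num_tuple m : r.-tuple R :=
  [tuple rev_par (m %/ r.+1) (num_par a m (widen_ord (leqnSn r) i)) | i < r].
Definition den_tuple m : s.-tuple R :=
  [tuple rev_par (m %/ r.+1) (den_par r lam b m j) | j < s].
Definition rec_poly_coef0 m : R :=
  rev_coef (num_par a m) (den_par r lam b m) (m %/ r.+1).
Definition hyper_normalized m : {poly R} :=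
  \poly_(k < (m %/ r.+1).+1)
    hyper_coef (- (m %/ r.+1)%:R :: den_tuple m) (num_tuple m) k.

Lemma num_par_last m : num_par a m ord_max = (m %/ r.+1)%:R.
Proof.
by rewrite /num_par /num_shift nth_default ?size_tuple //= subnn addn0; ring.
Qed.

Lemma div_period n p : (p <= r)%N -> ((r.+1 * n + p) %/ r.+1 = n)%N.
Proof. by move=> pr; rewrite mulnC divnMDl // divn_small ?addn0. Qed.

Lemma num_tupleE n p i : (p <= r)%N ->
  tnth (num_tuple (r.+1 * n + p)) i = tnth a i + (i < p)%N%:R.
Proof.
move=> pr; rewrite tnth_mktuple /rev_par div_period // /num_par /=.
rewrite (tnth_nth 1) /num_shift.
rewrite -addnA mulnC divnMDl //.
have -> : ((p + (r - i)) %/ r.+1 = (i < p)%N)%N.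
  have ir := ltn_ord i; case: ltnP => ip.
    rewrite (_ : p + (r - i) = (p - i.+1) + r.+1)%N; last by lia.
    by rewrite divn_shift // divn_small //; lia.
  by rewrite divn_small //; lia.
by rewrite natrD; ring.
Qed.

Hypothesis r_gt0 : (0 < r)%N.
Hypothesis lam_sorted : sorted ltn lam.
Hypothesis lam_bound : forall j : 'I_s, (1 <= tnth lam j <= r)%N.
Hypothesis a_gt0 : forall i : 'I_r, 0 < tnth a i.
Hypothesis b_gt0 : forall j : 'I_s, 0 < tnth b j.

Lemma rev_num_par_gt0 m i : 0 < rev_par (m %/ r.+1) (num_par a m i).
Proof.
have := num_par_ge a m i; have := nth_a_gt0 a_gt0 i.
by rewrite /rev_par; lra.
Qed.

Lemma den_par_gt m j : (r < m)%N -> (m %/ r.+1)%:R - 1 < den_par r lam b m j.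
Proof.
move=> rm; apply: lt_le_trans (den_par_ge b r_gt0 lam_sorted lam_bound j rm).
have : ((m %/ r.+1)%:R : R) <= (m.+1 %/ r.+1)%:R by rewrite ler_nat leq_div2r.
by have := b_gt0 j; lra.
Qed.

Lemma falling_den_gt0 m j : 0 < falling (den_par r lam b m j) (m %/ r.+1).
Proof.
have [mr|rm] := leqP m r; first by rewrite divn_small // falling0 ltr01.
exact/falling_gt0/den_par_gt.
Qed.

Lemma rec_poly_hyper m : rec_poly lam a b m = rec_poly_coef0 m *:
  hyper_normalized m.
Proof.
apply/polyP => k; rewrite coefZ !coef_poly.
case: ltnP => km; last by rewrite mulr0.
rewrite (rev_coef_hyper (A := num_par a m)) //.
- exact: num_par_last.
- by move=> i; exact: rev_num_par_gt0.
- by move=> j; rewrite gt_eqF // falling_den_gt0.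
Qed.

Lemma rec_poly_coef0_sign m : 0 < (-1) ^+ (m %/ r.+1) * rec_poly_coef0 m.
Proof.
rewrite /rec_poly_coef0 /rev_coef !mulrA -expr2 sqrr_sign mul1r.
rewrite divr_gt0 ?mulr_gt0 ?invr_gt0 ?ltr0n ?fact_gt0 //; last first.
  by apply: prodr_gt0 => j _; exact: falling_den_gt0.
apply: prodr_gt0 => i _; apply: falling_gt0.
by have := rev_num_par_gt0 m i; rewrite /rev_par; lra.
Qed.

Lemma den_tuple_gt0 m j : (r < m)%N -> 0 < tnth (den_tuple m) j.
Proof.
by move=> rm; rewrite tnth_mktuple /rev_par; have := den_par_gt j rm; lra.
Qed.

Lemma den_tupleE n p j : (p <= r)%N -> tnth (den_tuple (r.+1 * n + p)) j =
  tnth b j + ((n + p + (r.*2.-1 - tnth lam j)) %/ r)%:R - 1.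
Proof.
move=> pr; rewrite tnth_mktuple /rev_par div_period // /den_par /den_shift.
rewrite (_ : (_ + _ + _ = n * r + (n + p + (r.*2.-1 - tnth lam j)))%N);
  last by lia.
by rewrite divnMDl // natrD; ring.
Qed.

Lemma den_tuple_shifted n :
  den_tuple (r.+1 * n) = shifted_b r lam b n.
Proof.
apply: eq_from_tnth => j; rewrite -[(r.+1 * n)%N]addn0 den_tupleE // addn0.
rewrite tnth_mktuple -addrA; congr (_ + _).
set N := (_ %/ r)%N.
have lr : (1 <= tnth lam j <= r)%N by [].
have N1 : (N * r <= n + (r.*2.-1 - tnth lam j))%N := leq_trunc_div _ _.
have N2 : (n + (r.*2.-1 - tnth lam j) < N.+1 * r)%N by rewrite -ltn_divLR.
have rR : (0 : R) < r%:R by rewrite ltr0n.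
have h1 : (N%:R * r%:R + (tnth lam j)%:R + 1 <= n%:R + 2 * r%:R :> R).
  rewrite -[2]/(2%:R) -!natrM -[1]/(1%:R) -!natrD ler_nat.
  by have /andP[] := lr; lia.
have h2 : (n%:R + r%:R <= N%:R * r%:R + (tnth lam j)%:R :> R).
  rewrite -!natrM -!natrD ler_nat.
  by have /andP[] := lr; lia.
rewrite (@ceil_def _ _ (N%:Z - 1)) ?intrB //=.
rewrite ltr_pdivlMr // ler_pdivrMr // -[N%:~R]/(N%:R).
by apply/andP; split; nra.
Qed.

End Identification.

(** * Limits and bounds of the scaled coefficients *)

Section Scaling.
Variables (R : realType) (r s : nat).
Hypothesis r_gt0 : (0 < r)%N.
Implicit Types (al : seq R) (be : nat -> s.-tuple R).

(** Here [n = N+1]. For fixed [k], [(-n)_k] behaves like [(-n)^k] and each of the [s] symbols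
    [(b_j^(n-1))_k] like [(n/r)^k]; replacing [x] by [scale N * x] cancels these powers. *)
Definition scale N : R := r%:R ^+ s / N.+1%:R ^+ s.+1.

Definition scaled al be N : {poly R} := \poly_(k < N.+2)
  (hyper_coef (- N.+1%:R :: be N) al k * scale N ^+ k).

Definition limit_coef al k : R := (-1) ^+ k * hyper_coef [::] al k.

Lemma cvg_prod_seq (I : Type) (l : seq I) (F : I -> nat -> R) (L : I -> R) :
  (forall i, F i n @[n --> \oo] --> L i) ->
  \prod_(i <- l) F i n @[n --> \oo] --> \prod_(i <- l) L i.
Proof.
move=> FL; elim: l => [|i l IHl].
  rewrite big_nil (_ : (fun n => _) = fun=> 1); first exact: cvg_cst.
  by apply/funext => n; rewrite big_nil.
rewrite big_cons (_ : (fun n => _) = fun n => F i n * \prod_(j <- l) F j n).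
  exact: cvgM.
by apply/funext => n; rewrite big_cons.
Qed.

(** Every factor is normalized separately, by [n] or by [n/r], so that it converges and stays
    bounded. The identity also covers [k > n], where the factor [u = n] vanishes. *)
Lemma coef_scaled al be N k : (scaled al be N)`_k =
  (\prod_(u < k) ((u%:R - N.+1%:R) / N.+1%:R)) *
  (\prod_(j < s) \prod_(u < k) ((tnth (be N) j + u%:R) * (r%:R / N.+1%:R))) *
  hyper_coef [::] al k.
Proof.
have n0 : (N.+1%:R : R) != 0 by rewrite pnatr_eq0.
have split_prod (x c : R) : \prod_(u < k) ((x + u%:R) * c) = pochhammer x k * c
  ^+ k.
  by rewrite big_split /= prodr_const card_ord.
have e1 : \prod_(u < k) ((u%:R - N.+1%:R) / N.+1%:R) =
    pochhammer (- N.+1%:R) k * (N.+1%:R ^-1) ^+ k :> R.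
  by rewrite -split_prod; apply: eq_bigr => u _; rewrite addrC.
have e2 : \prod_(j < s) \prod_(u < k) ((tnth (be N) j + u%:R) * (r%:R /
  N.+1%:R)) =
    \prod_(t <- be N) pochhammer t k * ((r%:R / N.+1%:R) ^+ k) ^+ s.
  transitivity (\prod_(j < s) (pochhammer (tnth (be N) j) k * (r%:R / N.+1%:R)
    ^+ k)).
    by apply: eq_bigr => j _; rewrite split_prod.
  by rewrite big_split /= prodr_const card_ord big_tuple.
rewrite coef_poly e1 e2; case: ltnP => kN; last first.
  by rewrite pochhammer_eq0 // !mul0r.
rewrite /hyper_coef big_cons big_nil /scale.
have -> : (r%:R / N.+1%:R) ^+ k ^+ s = ((r%:R ^+ s / N.+1%:R ^+ s) ^+ k : R).
  by rewrite -expr_div_n exprAC.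
have -> : (r%:R ^+ s / N.+1%:R ^+ s.+1) ^+ k =
    (r%:R ^+ s / N.+1%:R ^+ s) ^+ k * N.+1%:R^-1 ^+ k :> R.
  by rewrite -exprMn; congr (_ ^+ k); rewrite exprS invfM; ring.
by ring.
Qed.

Variables (al : seq R) (be : nat -> s.-tuple R) (B : R).
Hypothesis al_gt0 : forall t, t \in al -> 0 < t.
Hypothesis be_gt0 : forall N j, 0 < tnth (be N) j.
Hypothesis be_near : forall N j, `|tnth (be N) j - N.+1%:R / r%:R| <= B.

Let rR : (0 : R) < r%:R. Proof. by rewrite ltr0n. Qed.

Lemma scaled_coef_cvg : coef_cvg (scaled al be) (limit_coef al).
Proof.
move=> k; have -> : (fun N => (scaled al be N)`_k) = fun N =>
    (\prod_(u < k) ((u%:R - N.+1%:R) / N.+1%:R)) *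
    (\prod_(j < s) \prod_(u < k) ((tnth (be N) j + u%:R) * (r%:R / N.+1%:R))) *
    hyper_coef [::] al k.
  by apply/funext => N; rewrite coef_scaled.
apply: cvgM; last exact: cvg_cst.
have inv0 (x : R) : x * N.+1%:R^-1 @[N --> \oo] --> (0 : R).
  by rewrite -[X in _ --> X](mulr0 x); apply: cvgM;
    [exact: cvg_cst|exact: cvg_harmonic].
have -> : (-1) ^+ k = (\prod_(u < k) (-1)) * \prod_(j < s) \prod_(u < k) 1 :> R.
  rewrite prodr_const card_ord big1 ?mulr1 // => j _; exact: big1.
apply: cvgM; apply: cvg_prod_seq => j.
  have -> : (fun N : nat => (j%:R - N.+1%:R) / N.+1%:R) =
      fun N : nat => j%:R * N.+1%:R^-1 - (1 : R).
    by apply/funext => N; rewrite mulrBl divff ?pnatr_eq0.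
  by rewrite -[X in _ --> X]sub0r; apply: cvgB; [exact: inv0|exact: cvg_cst].
apply: cvg_prod_seq => u; apply/cvgrPdist_le => e e0.
have := inv0 ((B + u%:R) * r%:R) => /cvgrPdist_le/(_ _ e0).
apply: filterS => N; rewrite sub0r normrN => H.
have N0 : (0 : R) < N.+1%:R by rewrite ltr0n.
apply: le_trans H; apply: le_trans (ler_norm _).
have -> : 1 - (tnth (be N) j + u%:R) * (r%:R / N.+1%:R) =
   - ((tnth (be N) j - N.+1%:R / r%:R) + u%:R) * (r%:R * N.+1%:R^-1).
  by field; rewrite ?pnatr_eq0 ?gt_eqF.
have p0 : 0 <= r%:R / N.+1%:R :> R by rewrite divr_ge0.
rewrite normrM normrN (ger0_norm p0) -mulrA ler_wpM2r //.
by apply: le_trans (ler_normD _ _) _; rewrite lerD // ger0_norm.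
Qed.

Lemma scaled_dominated : exists M, 0 <= M /\ dominated 1 M (scaled al be).
Proof.
(* [M1] bounds [(b + u) r/n] for [b <= n/r + |B|] and [u <= n]; [M2] comes from [(t)_k >= t^k] for
   the parameters [t] in [al]. *)
pose M1 := 1 + r%:R * `|B| + r%:R.
have M10 : 0 <= M1 by rewrite !addr_ge0 ?mulr_ge0.
pose M2 := \prod_(t <- al) t^-1.
have M20 : 0 <= M2.
  by rewrite /M2 big_seq prodr_ge0 // => t /al_gt0 t0; rewrite invr_ge0 ltW.
exists (M1 ^+ s * M2); split; first by rewrite mulr_ge0 // exprn_ge0.
move=> N k; rewrite mul1r coef_scaled.
have n0 : (0 : R) < N.+1%:R by rewrite ltr0n.
have [kN|Nk] := leqP k N.+1; last first.
  rewrite (bigD1 (Ordinal Nk)) //= subrr !mul0r normr0 divr_ge0 // exprn_ge0 //.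
  by rewrite mulr_ge0 // exprn_ge0.
have uk (u : 'I_k) : (u%:R : R) <= N.+1%:R.
  by rewrite ler_nat ltnW // (leq_trans (ltn_ord u)).
have f1 : `|\prod_(u < k) ((u%:R - N.+1%:R) / N.+1%:R : R)| <= 1.
  rewrite normr_prod; apply: prodr_ile1 => u _; rewrite normr_ge0 /=.
  rewrite normrM normfV (gtr0_norm n0) ler_pdivrMr // mul1r distrC.
  by rewrite ger0_norm ?subr_ge0 // lerBlDr lerDl.
have f2 : `|\prod_(j < s) \prod_(u < k) ((tnth (be N) j + u%:R) * (r%:R /
  N.+1%:R))|
    <= (M1 ^+ s) ^+ k.
  rewrite normr_prod exprAC -[X in _ ^+ X](card_ord s) -prodr_const.
  apply: ler_prod => j _; rewrite normr_ge0 /= normr_prod.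
  rewrite -[X in _ ^+ X](card_ord k) -prodr_const.
  apply: ler_prod => u _; rewrite normr_ge0 /=.
  have t0 := be_gt0 N j.
  rewrite ger0_norm; last by rewrite mulr_ge0 ?divr_ge0 // addr_ge0 // ltW.
  have tb : tnth (be N) j <= N.+1%:R / r%:R + `|B|.
    have := be_near N j; rewrite ler_norml => /andP[_].
    by have := ler_norm B; lra.
  have n1 : (1 : R) <= N.+1%:R by rewrite ler1n.
  rewrite mulrA ler_pdivrMr //.
  have rB : 0 <= r%:R * `|B| by rewrite mulr_ge0.
  apply: (@le_trans _ _ ((N.+1%:R / r%:R + `|B| + N.+1%:R) * r%:R)).
    by rewrite ler_wpM2r // lerD.
  have -> : (N.+1%:R / r%:R + `|B| + N.+1%:R) * r%:R =
     N.+1%:R + r%:R * `|B| + r%:R * N.+1%:R by field; rewrite gt_eqF.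
  rewrite /M1 2!mulrDl mul1r lerD // lerD // ler_peMr //.
have f3 : `|hyper_coef [::] al k| <= M2 ^+ k / k`!%:R.
  rewrite /hyper_coef big_nil mul1r normrM !normfV.
  rewrite (ger0_norm (ler0n _ _)) ler_wpM2r // /M2 -prodrXl normr_prod -prodfV.
  rewrite big_seq [X in _ <= X]big_seq; apply: ler_prod => t tal.
  have t0 := al_gt0 tal; have pt := pochhammer_gt0 k t0.
  rewrite invr_ge0 normr_ge0 /= (gtr0_norm pt) exprVn.
  by rewrite lef_pV2 ?posrE ?exprn_gt0 // pochhammer_ge.
rewrite 2!normrM.
have -> : (M1 ^+ s * M2) ^+ k / k`!%:R = 1 * (M1 ^+ s) ^+ k * (M2 ^+ k / k`!%:R).
  by rewrite exprMn; ring.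
have f12 := ler_pM (normr_ge0 _) (normr_ge0 _) f1 f2.
by apply: (ler_pM _ (normr_ge0 _) f12 f3); rewrite mulr_ge0.
Qed.

End Scaling.

(** * The complex function [0Fr] at real points *)

Section ComplexHypergeometric.
Variable R : realType.

(* Only an abstract [numFieldType] carries a topology, hence this detour. *)
Lemma hypergeometric_rmorph (K : numFieldType) (h : {rmorphism R -> K})
    (a : seq R) (x F : R) :
  (forall e : K, 0 < e -> exists2 t, 0 < t & e = h t) ->
  (forall y t : R, `|y| <= t -> `|h y| <= h t) ->
  series (fun n => hyper_coef [::] a n * x ^+ n) @ \oo --> F ->
  hypergeometric [::] [seq h t | t <- a] (h x) = h F.
Proof.
move=> h_pos h_norm sF; apply/cvg_lim => //.
have -> : series (fun n => hyper_coef [::] [seq h t | t <- a] n * h x ^+ n) =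
    fun n => h (series (fun n => hyper_coef [::] a n * x ^+ n) n).
  apply/funext => n; rewrite /series /= rmorph_sum; apply: eq_bigr => k _.
  rewrite rmorphM rmorphXn; congr (_ * _).
  rewrite /hyper_coef !big_nil !mul1r big_map fmorph_div fmorphV rmorph_nat.
  congr (_^-1 / _); rewrite rmorph_prod; apply: eq_bigr => t _.
  by rewrite /pochhammer rmorph_prod; apply: eq_bigr => i _;
    rewrite rmorphD rmorph_nat.
apply/cvgrPdist_le => e /h_pos[t t0 ->].
move/cvgrPdist_le: sF => /(_ _ t0); apply: filterS => n /h_norm.
by rewrite rmorphB.
Qed.

Lemma hypergeometric_real_complex (a : seq R) (x F : R) :
  series (fun n => hyper_coef [::] a n * x ^+ n) @ \oo --> F ->
  hypergeometric [::] [seq real_complex R t | t <- a] x%:C%C = F%:C%C.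
Proof.
apply: (hypergeometric_rmorph (K := R[i]) (h := real_complex R)).
  move=> e e0; have /complex_realP[t Et] := gtr0_real e0.
  by exists t; rewrite // -ltcR -Et.
by move=> y t yt; rewrite normc_def /= expr0n addr0 sqrtr_sqr lecR.
Qed.

Variables (C M : R) (a : seq R).
Hypothesis M_ge0 : 0 <= M.
Hypothesis a_bounded : exp_bounded C M (limit_coef a).

Lemma hypergeometric_limit_coef (x : R) :
  hypergeometric [::] [seq real_complex R t | t <- a] (- x%:C%C) =
  (power_sum (limit_coef a) x)%:C%C.
Proof.
rewrite -rmorphN; apply: hypergeometric_real_complex.
have -> : (fun n => hyper_coef [::] a n * (- x) ^+ n) =
    fun n => limit_coef a n * x ^+ n.
  by apply/funext => n; rewrite /limit_coef [(- x) ^+ n]exprNn mulrCA mulrA.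
exact: power_sum_cvg M_ge0 a_bounded.
Qed.

Hypothesis a_gt0 : forall t, t \in a -> 0 < t.

(** For [x <= 0] all terms of the series are nonnegative and the first is 1. It follows that the
    zeros [f_k] are positive, as the start of the induction on zeros requires. *)
Lemma power_sum_limit_coef_gt0 (x : R) : x <= 0 ->
  0 < power_sum (limit_coef a) x.
Proof.
move=> x0; apply: lt_le_trans ltr01 _.
have h := power_sum_cvg (x := x) M_ge0 a_bounded.
apply: (cvgr_to_ge h); near=> n.
have n0 : (0 < n)%N by near: n; exact: nbhs_infty_gt.
rewrite /series /= (big_ltn n0) {1}/limit_coef /hyper_coef big_nil expr0 !mul1r.
rewrite big1 ?fact0 ?divr1 ?invr1 ?mulr1 => [|t _];
  last by rewrite /pochhammer big_ord0.
rewrite lerDl big_seq; apply: sumr_ge0 => k _.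
rewrite /limit_coef mulrAC -exprMn mulN1r mulr_ge0 ?exprn_ge0 ?oppr_ge0 //.
rewrite /hyper_coef big_nil mul1r divr_ge0 // invr_ge0 big_seq.
by apply: prodr_ge0 => t /a_gt0 t0; rewrite ltW // pochhammer_gt0.
Unshelve. all: by end_near. Qed.

End ComplexHypergeometric.

Lemma rootsR_prodX (R : rcfType) (xs : seq R) : sorted <%R xs ->
  rootsR (prodX xs) = xs.
Proof.
move=> sxs; apply: lt_sorted_eq => //; first exact: sorted_roots.
move=> x; rewrite -[RHS]root_prodX.
have nz : prodX xs != 0 by rewrite monic_neq0 // monic_prod_XsubC.
by rewrite -(roots_on_rootsR nz) in_itv.
Qed.

Lemma comp_poly_scale (R : comNzRingType) n (E : nat -> R) (c : R) :
  (\poly_(k < n) E k) \Po (c *: 'X) = \poly_(k < n) (E k * c ^+ k).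
Proof.
rewrite !poly_def raddf_sum; apply: eq_bigr => k _ /=.
by rewrite comp_polyZ rmorphXn /= comp_polyX exprZn scalerA.
Qed.

Lemma wronskian_comp_scale (R : comNzRingType) (c x : R) (f g : {poly R}) :
  ((f \Po (c *: 'X)) * (g \Po (c *: 'X))^`()
   - (f \Po (c *: 'X))^`() * (g \Po (c *: 'X))).[x] =
  c * (f * g^`() - f^`() * g).[c * x].
Proof.
rewrite !deriv_comp derivZ derivX !(hornerD, hornerN, hornerM, horner_comp,
  hornerZ, hornerX, hornerC).
by ring.
Qed.

(** * Consequences for the zeros of [P_n] *)

Section HyperPoly.
Variables (R : realType) (r s : nat).
Variables (lam : s.-tuple nat) (a : r.-tuple R) (b : s.-tuple R).
Hypothesis r_gt0 : (0 < r)%N.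
Hypothesis adm : admissible lam a b.

Let lam_sorted : sorted ltn lam. Proof. by case: adm => [[]]. Qed.
Let lam_bound : forall j : 'I_s, (1 <= tnth lam j <= r)%N.
Proof. by case: adm => [[]]. Qed.
Let a_gt0 : forall i : 'I_r, 0 < tnth a i. Proof. by case: adm. Qed.
Let b_gt0 : forall j : 'I_s, 0 < tnth b j. Proof. by case: adm. Qed.
Let lt_ab : forall (i : 'I_r) (j : 'I_s),
  (i < tnth lam j)%N -> tnth a i < tnth b j.
Proof. by case: adm. Qed.
Let lt_a1b : forall (i : 'I_r) (j : 'I_s),
  (tnth lam j <= i)%N -> tnth a i - 1 < tnth b j.
Proof. by case: adm. Qed.

Local Notation P := (hyper_poly lam a b).
Local Notation q := (rec_poly lam a b).
Local Notation H := (hyper_normalized lam a b).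

Let q_init := rec_poly_init lam a b.
Let q_rec := rec_poly_rec a r_gt0 lam_sorted lam_bound b_gt0.
Let gam_pos := gam_gt0 r_gt0 lam_sorted lam_bound a_gt0 b_gt0 lt_ab lt_a1b.

Lemma num_tuple_period n : num_tuple a (r.+1 * n) = a.
Proof.
apply: eq_from_tnth => i.
by rewrite -[(r.+1 * n)%N]addn0 num_tupleE // addr0.
Qed.

Lemma hyper_poly_rec_poly n : P n = q (r.+1 * n).
Proof.
rewrite (rec_poly_hyper r_gt0 lam_sorted lam_bound a_gt0 b_gt0) /hyper_poly
  /hyper_normalized.
rewrite (den_tuple_shifted b r_gt0 lam_sorted lam_bound) num_tuple_period mulKn
  //.
congr (_ *: _); rewrite /hyper_prefactor /rec_poly_coef0 /rev_coef mulKn //.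
rewrite big_ord_recr /= num_par_last mulKn // falling_nat.
have f0 : (n`!%:R : R) != 0 by rewrite pnatr_eq0 -lt0n fact_gt0.
have fp z : falling z n = pochhammer (rev_par n z) n :> R.
  by rewrite (falling_pochhammer z (leqnn n)) subnn falling0 mul1r.
have -> : \prod_(t <- a) pochhammer t n =
    \prod_(i < r) falling (num_par a (r.+1 * n) (widen_ord (leqnSn r) i)) n.
  rewrite big_tuple; apply: eq_bigr => i _.
  by rewrite fp -[in LHS](num_tuple_period n) tnth_mktuple mulKn.
have -> : \prod_(t <- shifted_b r lam b n) pochhammer t n =
    \prod_j falling (den_par r lam b (r.+1 * n) j) n.
  rewrite -(den_tuple_shifted b r_gt0 lam_sorted lam_bound) big_tuple.
  by apply: eq_bigr => j _; rewrite tnth_mktuple mulKn // -fp.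
by congr (_ / _); rewrite -mulrA [_^-1 * _]mulrC mulfK.
Qed.

Lemma hyper_poly_split n : exists xs : seq R, [/\ size xs = n,
  sorted <%R xs, all (> 0) xs & P n = prodX xs].
Proof.
have := rec_splits r_gt0 q_init q_rec gam_pos (r.+1 * n).
by rewrite /splits_positively mulKn // -hyper_poly_rec_poly.
Qed.

Lemma hyper_poly_complex_roots n (z : R[i]) :
  root (map_poly (real_complex R) (P n)) z ->
  [/\ mup z (map_poly (real_complex R) (P n)) = 1%N, z \is Num.real & 0 < z].
Proof.
have [xs [_ sxs xs0 ->]] := hyper_poly_split n.
have -> : map_poly (real_complex R) (prodX xs) =
    \prod_(y <- [seq real_complex R x | x <- xs]) ('X - y%:P).
  rewrite /prodX rmorph_prod big_map; apply: eq_bigr => x _.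
  exact: map_polyXsubC.
rewrite root_prod_XsubC => /mapP[x xxs Ez].
have x0 : 0 < z by rewrite Ez ltcR; exact: (allP xs0).
split=> //; last exact: gtr0_real.
rewrite mu_prod_XsubC count_uniq_mem; first by rewrite Ez map_f.
by rewrite map_inj_uniq ?lt_sortedW //; exact: fmorph_inj.
Qed.

Lemma hyper_poly_interlaced n : interlaced_by (P n.+1) (P n).
Proof.
have [xs [sx sxs _ Ex]] := hyper_poly_split n.
have [ys [sy sys _ Ey]] := hyper_poly_split n.+1.
have pre : precedes (prodX xs) (prodX ys).
  rewrite -Ex -Ey !hyper_poly_rec_poly.
  exact: (rec_precedes_period r_gt0 q_init q_rec gam_pos).
rewrite /interlaced_by /consecutive_roots Ex Ey => x y [xy rx ry nr].
apply: (precedes_interlaced sxs sys _ pre xy rx ry nr).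
by right; rewrite sy sx.
Qed.

Lemma hyper_poly_root_lt n x al : root (P n) x -> (0 < n)%N ->
    (forall i, nth 1 a i <= al) ->
  x < 2 ^+ r.+1 * (n%:R + al) ^+ (r - s).
Proof.
move=> rx n0 aal; rewrite ltNge; apply/negP => Xx.
have al0 : 0 < al by apply: lt_le_trans (nth_a_gt0 a_gt0 0) (aal 0%N).
have na : 0 < n%:R + al by rewrite addr_gt0 // ltr0n.
have x0 : 0 < x.
  by apply: lt_le_trans Xx; rewrite mulr_gt0 ?exprn_gt0.
have : 0 < (q (r.+1 * n)).[x].
  apply: (rec_gt0 r_gt0 q_init q_rec gam_pos x0) => m /andP[rm mM].
  apply: le_trans Xx; rewrite ler_pM2l ?exprn_gt0 //.
  apply: gam_le => // [i|_ i]; last exact: (num_par_le r_gt0 lam_sorted).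
  rewrite (tnth_nth 1); apply: le_trans (aal _) _.
  by rewrite lerDr.
by rewrite -hyper_poly_rec_poly (rootP rx) ltxx.
Qed.

(** The numerators inside a block: [p] of them are already raised. The value [p = 0] gives [P_n],
    and [p = r-1], where only the last one is not raised, gives the companion used for
    simplicity. *)
Definition scaled_num p : r.-tuple R := [tuple tnth a i + (i < p)%N%:R | i < r].
Definition scaled_den p N := den_tuple r lam b (r.+1 * N.+1 + p).
Definition scaled_poly p N := scaled r (scaled_num p) (scaled_den p) N.

Lemma scale_gt0 N : 0 < scale R r s N.
Proof. by rewrite /scale divr_gt0 // exprn_gt0 // ltr0n. Qed.

Lemma scaled_polyE p N : (p <= r)%N ->
  scaled_poly p N = (H (r.+1 * N.+1 + p)) \Po (scale R r s N *: 'X).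
Proof.
move=> pr; rewrite /hyper_normalized div_period // comp_poly_scale.
have -> // : num_tuple a (r.+1 * N.+1 + p) = scaled_num p.
by apply: eq_from_tnth => i; rewrite num_tupleE // [RHS]tnth_mktuple.
Qed.

Lemma scaled_num_gt0 p t : t \in scaled_num p -> 0 < t.
Proof. by case/tnthP => i ->; rewrite tnth_mktuple ltr_wpDr. Qed.

Lemma scaled_den_gt0 p N j : 0 < tnth (scaled_den p N) j.
Proof.
apply: (den_tuple_gt0 r_gt0 lam_sorted lam_bound b_gt0).
by rewrite mulnS -addnA ltn_addr.
Qed.

Lemma scaled_den_near p N j : (p <= r)%N ->
  `|tnth (scaled_den p N) j - N.+1%:R / r%:R| <= \sum_i tnth b i + 2.
Proof.
move=> pr; rewrite (den_tupleE b r_gt0 lam_sorted) //.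
set Y := (_ %/ r)%N; have rR : (0 : R) < r%:R by rewrite ltr0n.
have Y1 : (Y * r <= N.+1 + 3 * r)%N.
  by apply: leq_trans (leq_trunc_div _ _) _; lia.
have Y2 : (N.+1 <= Y.+1 * r)%N.
  apply: ltnW; apply: leq_ltn_trans (ltn_ceil _ r_gt0); lia.
have y1 : (Y%:R : R) <= N.+1%:R / r%:R + 3.
  rewrite -(ler_pM2r rR) mulrDl divfK ?gt_eqF //.
  by rewrite -[3]/(3%:R) -!natrM -natrD ler_nat.
have y2 : (N.+1%:R / r%:R : R) <= Y%:R + 1.
  by rewrite ler_pdivrMr // natr1 -natrM ler_nat.
have bj : tnth b j <= \sum_i tnth b i.
  rewrite (bigD1 j) //= lerDl sumr_ge0 // => i _; exact: ltW.
by have := b_gt0 j; rewrite ler_norml => b0; apply/andP; split; lra.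
Qed.

Lemma scaled_poly_dominated p : (p <= r)%N ->
  exists M, 0 <= M /\ dominated 1 M (scaled_poly p).
Proof.
move=> pr; apply: (scaled_dominated r_gt0 (B := \sum_i tnth b i + 2)).
- exact: scaled_num_gt0.
- exact: scaled_den_gt0.
- by move=> N j; exact: scaled_den_near.
Qed.

Lemma scaled_poly_cvg p : (p <= r)%N ->
  coef_cvg (scaled_poly p) (limit_coef (scaled_num p)).
Proof.
move=> pr; apply: (scaled_coef_cvg r_gt0 (B := \sum_i tnth b i + 2)).
by move=> N j; exact: scaled_den_near.
Qed.

Lemma scaled_num0 : scaled_num 0 = a.
Proof. by apply: eq_from_tnth => i; rewrite tnth_mktuple addr0. Qed.

Let last_r : (r.-1 < r)%N. Proof. by rewrite prednK. Qed.
Definition last_ord : 'I_r := Ordinal last_r.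

Lemma limit_coef_pred k : limit_coef (scaled_num r.-1) k =
  - (\prod_(i | i != last_ord) tnth a i) * (k%:R + 1)
  * (tnth a last_ord + k%:R) * limit_coef a k.+1.
Proof.
rewrite /limit_coef /hyper_coef !big_nil !mul1r.
have -> : \prod_(t <- scaled_num r.-1) pochhammer t k =
    pochhammer (tnth a last_ord) k
    * \prod_(i | i != last_ord) pochhammer (tnth a i + 1) k.
  rewrite big_tuple (bigD1 last_ord) //= tnth_mktuple ltnn addr0; congr (_ * _).
  apply: eq_bigr => i ir; rewrite tnth_mktuple (_ : (i < r.-1)%N) //.
  have := ltn_ord i; move: ir; rewrite -val_eqE /=; lia.
have -> : \prod_(t <- a) pochhammer t k.+1 =
    pochhammer (tnth a last_ord) k * (tnth a last_ord + k%:R)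
    * (\prod_(i | i != last_ord) tnth a i
       * \prod_(i | i != last_ord) pochhammer (tnth a i + 1) k).
  rewrite big_tuple (bigD1 last_ord) //= pochhammerSr; congr (_ * _).
  by rewrite -big_split; apply: eq_bigr => i _; rewrite pochhammerSl.
have f0 : (k`!%:R : R) != 0 by rewrite pnatr_eq0 -lt0n fact_gt0.
have k0 : (k%:R + 1 : R) != 0 by rewrite natr1 pnatr_eq0.
have n1 : pochhammer (tnth a last_ord) k != 0 by rewrite gt_eqF // pochhammer_gt0.
have n2 : tnth a last_ord + k%:R != 0 by rewrite gt_eqF // ltr_wpDr.
have n3 : \prod_(i | i != last_ord) tnth a i != 0.
  by apply/prodf_neq0 => i _; rewrite gt_eqF.
have n4 : \prod_(i | i != last_ord) pochhammer (tnth a i + 1) k != 0.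
  by apply/prodf_neq0 => i _; rewrite gt_eqF // pochhammer_gt0 // ltr_wpDr.
rewrite exprS factS natrM -natr1.
by field; rewrite f0 k0 n1 n2 n3 n4.
Qed.

(** The monic terms interlace, being in one window; the passage to constant term 1 divides each by a
    number of sign [(-1)^n], the same for both, and rescaling the variable multiplies the Wronskian
    by a positive constant. *)
Lemma scaled_wronskian_ge0 N x :
  0 <= (wronskian (scaled_poly 0 N) (scaled_poly r.-1 N)).[x].
Proof.
have r1 : (r.-1 <= r)%N by rewrite leq_pred.
rewrite !scaled_polyE // /wronskian wronskian_comp_scale.
rewrite mulr_ge0 ?(ltW (scale_gt0 _)) //.
set y := _ * x; set m0 := (_ + 0)%N; set m1 := (_ + r.-1)%N.
rewrite -/(wronskian (H m0) (H m1)).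
have E0 := rec_poly_hyper r_gt0 lam_sorted lam_bound a_gt0 b_gt0 m0.
have E1 := rec_poly_hyper r_gt0 lam_sorted lam_bound a_gt0 b_gt0 m1.
have S0 := rec_poly_coef0_sign r_gt0 lam_sorted lam_bound a_gt0 b_gt0 m0.
have S1 := rec_poly_coef0_sign r_gt0 lam_sorted lam_bound a_gt0 b_gt0 m1.
rewrite /m0 /m1 !div_period // -/m0 -/m1 in S0 S1.
have LL : 0 < rec_poly_coef0 lam a b m0 * rec_poly_coef0 lam a b m1.
  have := mulr_gt0 S0 S1.
  by rewrite mulrACA -expr2 sqrr_sign mul1r.
have WE : (wronskian (q m0) (q m1)).[y] =
    rec_poly_coef0 lam a b m0 * rec_poly_coef0 lam a b m1 * (wronskian (H m0)
      (H m1)).[y].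
  rewrite E0 E1 /wronskian !derivZ !(hornerD, hornerN, hornerM, hornerZ); ring.
rewrite -(pmulr_rge0 _ LL) -WE.
(* For [r = 1] the companion is the term itself and the Wronskian is 0; the limit then satisfies
   [F = - (a_1 F' + z F'')]. *)
have [r0|r0] := posnP r.-1.
  by rewrite /m1 r0 /wronskian mulrC subrr horner0.
have [xs [sx sxs _ Ex]] := rec_splits r_gt0 q_init q_rec gam_pos m0.
have [qm sq] := rec_size_monic q_init q_rec gam_pos m1.
rewrite Ex; apply: wronskian_ge0 => //.
  by left; rewrite sq sx /m0 /m1 !div_period.
rewrite -Ex; apply: (rec_precedes r_gt0 q_init q_rec gam_pos).
by rewrite /m0 /m1 addn0 -{1}[(r.+1 * N.+1)%N]addn0 ltn_add2l r0 leq_add2l.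
Qed.

Lemma limit_zero_derivative_neq0 w : 0 < w -> power_sum (limit_coef a) w = 0 ->
  power_sum (nderiv_seq 1 (limit_coef a)) w != 0.
Proof.
move=> w0 Fw.
have r1 : (r.-1 <= r)%N by rewrite leq_pred.
have [M [M0 dp]] := scaled_poly_dominated (leq0n r).
have [M' [M'0 dg]] := scaled_poly_dominated r1.
have cp := scaled_poly_cvg (leq0n r); rewrite scaled_num0 in cp.
have cg := scaled_poly_cvg r1.
apply: (limit_zero_simple M0 dp cp M'0 dg cg _ _ limit_coef_pred
  scaled_wronskian_ge0 w0 Fw).
- rewrite /limit_coef /hyper_coef big_nil expr0 !mul1r fact0 invr1 mulr1.
  by rewrite big1 ?invr1 ?oner_eq0 // => t _; rewrite pochhammer0.
- by apply: prodr_gt0.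
Qed.

Lemma root_scaled_poly N x :
  root (scaled_poly 0 N) x = root (P N.+1) (scale R r s N * x).
Proof.
rewrite scaled_polyE // addn0 hyper_poly_rec_poly.
rewrite (rec_poly_hyper r_gt0 lam_sorted lam_bound a_gt0 b_gt0) rootZ; last first.
  have := rec_poly_coef0_sign r_gt0 lam_sorted lam_bound a_gt0 b_gt0 (r.+1 *
    N.+1).
  by apply: contraTneq => ->; rewrite mulr0 ltxx.
by rewrite !rootE horner_comp hornerZ hornerX.
Qed.

Lemma small_zeros_cvg (f : nat -> R) :
    increasing_zeros (fun z : R[i] =>
      hypergeometric [::] [seq (real_complex R) t | t <- a] (- z)) f ->
  forall k : nat, (n%:R ^+ s.+1 * (rootsR (P n))`_k) @[n --> \oo]
    --> r%:R ^+ s * f k.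
Proof.
move=> [f_mono fP] k.
have [M [M0 dp]] := scaled_poly_dominated (leq0n r).
have cp := scaled_poly_cvg (leq0n r); rewrite scaled_num0 in cp.
have bc := exp_bounded_lim dp cp.
have FP x : power_sum (limit_coef a) x = 0 <-> exists k, x = f k.
  have := fP x%:C%C; rewrite (hypergeometric_limit_coef M0 bc) => -[h1 h2].
  split=> [Fx|[l ->]].
    have [|l El] := h1; first by rewrite Fx.
    by exists l; apply: complexI El.
  apply: complexI; rewrite -(hypergeometric_limit_coef M0 bc).
  by apply/fP; exists l.
have apos t : t \in tval a -> 0 < t by case/tnthP => i ->.
have fpos l : 0 < f l.
  rewrite ltNge; apply/negP => /(power_sum_limit_coef_gt0 M0 bc apos).
  have /FP -> : exists i, f l = f i by exists l.
  by rewrite ltxx.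
pose ys N := [seq x / scale R r s N | x <- rootsR (P N.+1)].
have rootsP n : exists xs : seq R,
    [/\ sorted <%R xs, all (> 0) xs, P n = prodX xs & rootsR (P n) = xs].
  have [xs [_ sxs xs0 E]] := hyper_poly_split n.
  by exists xs; split=> //; rewrite E rootsR_prodX.
have ysP N : [/\ sorted <%R (ys N), all (> 0) (ys N)
    & forall x, root (scaled_poly 0 N) x = (x \in ys N)].
  have [xs [sxs xs0 E Er]] := rootsP N.+1; have sc0 := scale_gt0 N.
  split.
  - rewrite /ys Er sorted_map; apply: sub_sorted sxs => x y /= xy.
    by rewrite /= ltr_pM2r // invr_gt0.
  - by rewrite /ys Er all_map; apply: sub_all xs0 => x /= x0; rewrite divr_gt0.
  - move=> x; rewrite root_scaled_poly E root_prodX /ys Er.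
    apply/idP/mapP => [xin|[y yin ->]].
      by exists (scale R r s N * x); rewrite // mulrC mulKf // gt_eqF.
    by rewrite mulrC divfK // gt_eqF.
have H0 l : power_sum (nderiv_seq 1 (limit_coef a)) (f l) != 0.
  by apply: limit_zero_derivative_neq0 => //; apply/FP; exists l.
have := roots_cvg M0 dp cp ysP f_mono (fpos 0%N) FP H0 (k := k) => hk.
rewrite -cvg_shiftS.
have -> : [sequence n.+1%:R ^+ s.+1 * (rootsR (P n.+1))`_k]_n =
    fun n => r%:R ^+ s * (ys n)`_k.
  apply/funext => n /=.
  have -> : (ys n)`_k = (rootsR (P n.+1))`_k / scale R r s n.
    have [kn|nk] := ltnP k (size (rootsR (P n.+1))).
      by rewrite (nth_map 0).
    by rewrite !nth_default ?size_map // mul0r.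
  rewrite /scale; field.
  by rewrite !expf_neq0 // pnatr_eq0 -?lt0n.
by apply: cvgM => //; exact: cvg_cst.
Qed.

Lemma largest_zero_bound : exists e : nat -> R,
  e =o_\oo (fun n : nat => n%:R ^+ (r - s) : R) /\
  \forall n \near \oo,
    (rootsR (P n))`_n.-1 < 2 ^+ r.+1 * n%:R ^+ (r - s) + e n.
Proof.
(* Exceeds every [a_i] as well as the completing parameter 1. *)
pose al := \sum_i tnth a i + 1.
have aal i : nth 1 a i <= al.
  have S0 : 0 <= \sum_i tnth a i by apply: sumr_ge0 => j _; exact: ltW.
  have [ir|ri] := ltnP i r; last first.
    by rewrite nth_default ?size_tuple // /al lerDr.
  rewrite -[X in nth _ _ X]/(nat_of_ord (Ordinal ir)) -tnth_nth /al (bigD1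
    (Ordinal ir)) //=.
  by rewrite -addrA lerDl addr_ge0 // sumr_ge0 // => j _; exact: ltW.
(* The cost of replacing [n + al] by [n], negligible because [(1 + al/n)^(r-s)] tends to 1. *)
pose e n : R := 2 ^+ r.+1 * ((n%:R + al) ^+ (r - s) - n%:R ^+ (r - s)).
exists e; split; last first.
  near=> n; have n0 : (0 < n)%N by near: n; exact: nbhs_infty_gt.
  have -> : 2 ^+ r.+1 * n%:R ^+ (r - s) + e n = 2 ^+ r.+1 * (n%:R + al) ^+ (r -
    s).
    by rewrite /e; ring.
  apply: hyper_poly_root_lt => //.
  have [xs [sx sxs _ E]] := hyper_poly_split n.
  by rewrite E rootsR_prodX // root_prodX mem_nth // sx prednK.
apply/eqoP => d d0.
have lim1 : \prod_(i < r - s) (1 + al * n.+1%:R^-1) @[n --> \oo] -->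
    \prod_(i < r - s) (1 : R).
  apply: cvg_prod_seq => i.
  rewrite -[X in _ --> X]addr0; apply: cvgD; first exact: cvg_cst.
  by rewrite -[X in _ --> X](mulr0 al); apply: cvgM;
    [exact: cvg_cst|exact: cvg_harmonic].
have d20 : 0 < d / 2 ^+ r.+1 by rewrite divr_gt0 // exprn_gt0.
move/cvgrPdist_le: lim1 => /(_ _ d20)[N0 _ NP].
exists N0.+1 => //; case=> [//|n] /=; rewrite ltnS => /NP /=.
rewrite !prodr_const card_ord expr1n distrC => h.
have n0 : (0 : R) < n.+1%:R by rewrite ltr0n.
rewrite /e normrM ger0_norm ?exprn_ge0 //.
have -> : n.+1%:R + al = (1 + al / n.+1%:R) * n.+1%:R.
  by rewrite mulrDl mul1r divfK // gt_eqF.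
rewrite exprMn -[X in _ * _ - X]mul1r -mulrBl normrM mulrA.
rewrite ler_wpM2r // mulrC -ler_pdivlMr // exprn_gt0 //.
Unshelve. all: by end_near. Qed.

End HyperPoly.

Theorem theorem8p4 (R : realType) (r s : nat) (hsr : (s <= r)%N)
    (hr : r <> 0%N) :
  exists K : R, 0 < K /\
  forall (lam : s.-tuple nat) (a : r.-tuple R) (b : s.-tuple R),
  admissible lam a b ->
  let P := hyper_poly lam a b in
  [/\ (forall n : nat,
        (forall z : R[i], root (map_poly (real_complex R) (P n)) z ->
          [/\ mup z (map_poly (real_complex R) (P n)) = 1%N,
              z \is Num.real & 0 < z])
        /\ interlaced_by (P n.+1) (P n)),
      (forall f : nat -> R,
        increasing_zeros
          (fun z : R[i] =>
             hypergeometric [::] [seq (real_complex R) t | t <- a] (- z)) f ->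
        forall k : nat,
          (n%:R ^+ s.+1 * (rootsR (P n))`_k) @[n --> \oo]
            --> r%:R ^+ s * f k)
    & (exists e : nat -> R,
        e =o_\oo (fun n : nat => n%:R ^+ (r - s) : R) /\
        \forall n \near \oo,
          (rootsR (P n))`_n.-1 < K * n%:R ^+ (r - s) + e n)].
Proof.
have r_gt0 : (0 < r)%N by rewrite lt0n; apply/eqP.
exists (2 ^+ r.+1); split; first by rewrite exprn_gt0.
move=> lam a b adm P; split.
- move=> n; split; first by move=> z; exact: hyper_poly_complex_roots.
  exact: hyper_poly_interlaced.
- by move=> f; exact: small_zeros_cvg.
- exact: largest_zero_bound.
Qed.
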